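(* Let $\mathcal{X}$ be a (real or complex) Banach space with $\dim \mathcal{X}\geq 2$, let $\mathcal{N}$ be a nest on $\mathcal{X}$ such that each $N\in\mathcal{N}$ with $N_{-}=N$ is complemented in $\mathcal{X}$, and let $\delta,\tau: Alg\mathcal{N}\rightarrow Alg\mathcal{N}$ be linear maps. Then the following are equivalent: (a) for all $A,B\in Alg\mathcal{N}$ with $AB=0$ one has $\delta(A)B+A\tau(B)=0$; (b) there exists a unique linear map $\gamma: Alg\mathcal{N}\rightarrow Alg\mathcal{N}$, of the form $\gamma(A)=RA+AT$ (for all $A \in Alg\mathcal{N}$) for some $R,T\in Alg\mathcal{N}$, such that $(\gamma,\delta,\tau)$ is a ternary derivation of $Alg\mathcal{N}$.
   Context: A nest $\mathcal{N}$ on a Banach space $\mathcal{X}$ is a chain (under inclusion) of norm-closed subspaces of $\mathcal{X}$ containing $\{0\}$ and $\mathcal{X}$ such that for every family $\{N_i\}$ of elements of $\mathcal{N}$, both $\bigcap N_i$ and $\bigvee N_i$ (the closed linear span of the $N_i$) belong to $\mathcal{N}$. The nest algebra $Alg\mathcal{N}$ is the algebra of all bounded linear operators on $\mathcal{X}$ that leave every member of $\mathcal{N}$ invariant. For $N\in\mathcal{N}$, $N_{-}:=\bigvee\{M\in\mathcal{N} : M\subsetneq N\}$. A ternary derivation of an associative algebra $\mathcal{A}$ is a triple $(\gamma,\delta,\tau)$ of linear maps $\mathcal{A}\to\mathcal{A}$ such that $\gamma(ab)=\delta(a)b+a\tau(b)$ for all $a,b\in\mathcal{A}$. Linear maps are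 linear over the scalar field of $\mathcal{X}$ and are not assumed continuous. *)

(* Defs.v *)
From HB Require Import structures.
From mathcomp Require Import all_boot all_order all_algebra.
From mathcomp Require Import all_classical all_reals all_analysis.
From mathcomp Require Import complex.

Set Implicit Arguments.
Unset Strict Implicit.
Unset Printing Implicit Defensive.

Import Order.TTheory GRing.Theory Num.Theory.
Import numFieldNormedType.Exports.

Local Open Scope classical_set_scope.
Local Open Scope ring_scope.

Inductive real_or_complex : numFieldType -> Prop :=
| RealScalars (R : realType) : real_or_complex R
| ComplexScalars (R : realType) : real_or_complex R[i].

Section Subspaces.
Context {K : numFieldType} {X : normedModType K}.
Implicit Types (A M L : set X).

Definition dim_ge2 : Prop :=
  exists x y : X, forall a b : K, a *: x + b *: y = 0 -> a = 0 /\ b = 0.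

Definition closed_subspace M : Prop :=
  submod_closed (mem M) /\ closed M.

Definition linear_span A : set X :=
  [set x | exists (n : nat) (c : 'I_n -> K) (v : 'I_n -> X),
    (forall i, A (v i)) /\ x = \sum_(i < n) c i *: v i].

Definition closed_span A : set X := closure (linear_span A).

Definition complemented M : Prop :=
  exists L, [/\ closed_subspace L, M `&` L = [set 0]
            & [set x + y | x in M & y in L] = setT].

End Subspaces.
Arguments dim_ge2 {K} X.

Section Nests.
Context {K : numFieldType} (X : normedModType K).

Record is_nest (N : set (set X)) : Prop := IsNest {
  nest_closed_subspace : forall M, N M -> closed_subspace M;
  nest_chain : total_on N subset;
  nest_zero : N [set 0];
  nest_full : N setT;
  nest_cap : forall F : set (set X), F `<=` N -> N (\bigcap_(M in F) M);
  nest_join : forall F : set (set X), F `<=` N ->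
    N (closed_span (\bigcup_(M in F) M))
}.

Record nest := Nest { nest_set :> set (set X); nestP : is_nest nest_set }.

Definition nest_pred (N : nest) (M : set X) : set X :=
  closed_span (\bigcup_(L in [set L | nest_set N L /\ L `<` M]) L).

End Nests.

Section NestAlgebra.
Context {K : numFieldType} {X : normedModType K}.

Definition bounded_operator (f : X -> X) : Prop :=
  linear f /\ exists C : K, forall x, `|f x| <= C * `|x|.

Definition nest_operators (N : nest X) : set (X -> X) :=
  [set f | bounded_operator f /\
           forall M, nest_set N M -> f @` M `<=` M].

Lemma bounded_operator0 : bounded_operator (0 : X -> X).
Proof.
split; first by move=> a u v /=; rewrite scaler0 addr0.
by exists 0 => x; rewrite normr0 mul0r.
Qed.

Lemma bounded_operator_comb (a : K) (f g : X -> X) :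
  bounded_operator f -> bounded_operator g -> bounded_operator (a *: f + g).
Proof.
move=> [lf [C hC]] [lg [D hD]]; split=> [b u v|].
  have E x : (a *: f + g) x = a *: f x + g x by [].
  by rewrite !E lf lg !scalerDr !scalerA (mulrC a) addrACA.
exists (`|a| * C + D) => x; rewrite mulrDl -mulrA.
apply: (le_trans (ler_normD _ _)); apply: lerD; last exact: hD.
by rewrite normrZ ler_wpM2l.
Qed.

Lemma bounded_operator_id : bounded_operator (@id X).
Proof. by split=> [//|]; exists 1 => x; rewrite mul1r. Qed.

Lemma bounded_operator_comp (f g : X -> X) :
  bounded_operator f -> bounded_operator g -> bounded_operator (f \o g).
Proof.
move=> [lf [C hC]] [lg [D hD]]; split=> [b u v|]; first by rewrite /= lg lf.
exists (`|C| * D) => x; apply: (le_trans (hC _)).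
have Cx : C * `|g x| <= `|C| * `|g x|.
  have h : 0 <= C * `|g x| by exact: le_trans (hC _).
  by rewrite -(normr_id (g x)) -normrM (normr_id (g x)) ger0_norm.
by apply: (le_trans Cx); rewrite -mulrA ler_wpM2l.
Qed.

Context (N : nest X).

Definition in_nest_alg (f : X -> X) : bool := f \in nest_operators N.

Lemma in_nest_algP f : reflect (nest_operators N f) (in_nest_alg f).
Proof. by apply: (iffP idP) => [/set_mem|/mem_set]. Qed.

Fact in_nest_alg_submod_closed : subsemimod_closed in_nest_alg.
Proof.
have sub M : nest_set N M -> M 0 /\
    forall a x y, M x -> M y -> M (a *: x + y).
  move=> /(nest_closed_subspace (nestP N)) [[M0 Mlin] _].
  split=> [|a x y Mx My]; first exact: set_mem M0.
  by apply: set_mem; apply: Mlin; apply: mem_set.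
have comb a f g : in_nest_alg f -> in_nest_alg g -> in_nest_alg (a *: f + g).
  move=> /in_nest_algP [bf If] /in_nest_algP [bg Ig]; apply/in_nest_algP.
  split=> [|M NM]; first exact: bounded_operator_comb.
  move=> _ [x Mx <-]; have [_] := sub M NM; apply.
    by apply: (If M NM); exists x.
  by apply: (Ig M NM); exists x.
have zero : in_nest_alg 0.
  apply/in_nest_algP; split=> [|M /sub[M0 _] _ [x _ <-] //].
  exact: bounded_operator0.
split=> [|a f hf]; last by rewrite -[X in X \in _]addr0; exact: comb.
by split=> [//|f g hf hg]; rewrite -[f]scale1r; exact: comb.
Qed.

HB.instance Definition _ := GRing.isSubmodClosed.Build K (X -> X) in_nest_alg
  in_nest_alg_submod_closed.

Record nest_alg := NestAlg {
  nest_alg_val :> X -> X;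
  nest_alg_valP : in_nest_alg nest_alg_val
}.

HB.instance Definition _ := [isSub for nest_alg_val].
HB.instance Definition _ := [Choice of nest_alg by <:].
HB.instance Definition _ := [SubChoice_isSubLmodule of nest_alg by <:].

Lemma nest_alg_ext (A B : nest_alg) : A =1 B -> A = B.
Proof. by move=> AB; apply/val_inj/funext. Qed.

Lemma nest_algP (A : nest_alg) : nest_operators N A.
Proof. exact/in_nest_algP/nest_alg_valP. Qed.

Fact nest_alg_id_subproof : in_nest_alg id.
Proof.
apply/in_nest_algP; split=> [|M _ _ [x Mx <-] //]; exact: bounded_operator_id.
Qed.

Fact nest_alg_comp_subproof (A B : nest_alg) : in_nest_alg (A \o B).
Proof.
have [[bA IA] [bB IB]] := (nest_algP A, nest_algP B).
apply/in_nest_algP; split=> [|M NM _ [x Mx <-]].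
  exact: bounded_operator_comp.
by apply: (IA M NM); exists (B x) => //; apply: (IB M NM); exists x.
Qed.

Definition nest_alg_one : nest_alg := NestAlg nest_alg_id_subproof.
Definition nest_alg_mul (A B : nest_alg) : nest_alg :=
  NestAlg (nest_alg_comp_subproof A B).

Fact nest_alg_mulA : associative nest_alg_mul.
Proof. by move=> A B C; apply: nest_alg_ext. Qed.
Fact nest_alg_mul1 : left_id nest_alg_one nest_alg_mul.
Proof. by move=> A; apply: nest_alg_ext. Qed.
Fact nest_alg_mulr1 : right_id nest_alg_one nest_alg_mul.
Proof. by move=> A; apply: nest_alg_ext. Qed.
Fact nest_alg_mulDl : left_distributive nest_alg_mul +%R.
Proof. by move=> A B C; apply: nest_alg_ext. Qed.
Fact nest_alg_mulDr : right_distributive nest_alg_mul +%R.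
Proof.
move=> A B C; apply: nest_alg_ext => x /=.
have [[lA _] _] := nest_algP A.
by have := lA 1 (B x) (C x); rewrite !scale1r.
Qed.

(* A pzRingType rather than an algType: the latter requires 1 != 0, which
   fails when X is the zero space. *)
HB.instance Definition _ := GRing.Zmodule_isPzRing.Build nest_alg
  nest_alg_mulA nest_alg_mul1 nest_alg_mulr1 nest_alg_mulDl nest_alg_mulDr.

Lemma nest_alg_oneE x : (1 : nest_alg) x = x.
Proof. by []. Qed.
Lemma nest_alg_mulE (A B : nest_alg) x : (A * B) x = A (B x).
Proof. by []. Qed.
Lemma nest_alg_addE (A B : nest_alg) x : (A + B) x = A x + B x.
Proof. by []. Qed.
Lemma nest_alg_scaleE (a : K) (A : nest_alg) x : (a *: A) x = a *: A x.
Proof. by []. Qed.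
Lemma nest_alg_zeroE x : (0 : nest_alg) x = 0.
Proof. by []. Qed.

Lemma nest_alg_scalerAl (a : K) (A B : nest_alg) : a *: (A * B) = (a *: A) * B.
Proof. by apply: nest_alg_ext. Qed.
Lemma nest_alg_scalerAr (a : K) (A B : nest_alg) : a *: (A * B) = A * (a *: B).
Proof.
apply: nest_alg_ext => x; have [[lA _] _] := nest_algP A.
rewrite nest_alg_scaleE !nest_alg_mulE nest_alg_scaleE.
have A0 : A 0 = 0 by have := lA (-1) 0 0; rewrite scaler0 addr0 scaleN1r addNr.
by have := lA a (B x) 0; rewrite A0 !addr0.
Qed.

Definition ternary_derivation
    (gamma delta tau : {linear nest_alg -> nest_alg}) : Prop :=
  forall A B : nest_alg, gamma (A * B) = delta A * B + A * tau B.

End NestAlgebra.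

(* Main.v *)
From HB Require Import structures.
Require Import Defs.
From mathcomp Require Import all_boot all_order all_algebra.
From mathcomp Require Import all_classical all_reals all_analysis.
From mathcomp Require Import complex ring lra.
Set Implicit Arguments.
Unset Strict Implicit.
Unset Printing Implicit Defensive.
Import Order.TTheory GRing.Theory Num.Theory.
Import numFieldNormedType.Exports.
Local Open Scope classical_set_scope.
Local Open Scope ring_scope.

(** A bilinear map that vanishes on the pairs with zero product cannot see where
    an idempotent [e] stands: applied to [phi A B = delta A * B + A * tau B], the
    zero products [A e * (1 - e) B] and [A (1 - e) * e B] give
    [phi (A e) B = phi A (e B)]. The rank one operators of the nest algebra are
    linear combinations of its idempotents ([rank_one_exchangeable]). This is
    where members with [M_- = M] must be complemented: the projection onto [M]
    is an idempotent of the algebra. Hence [phi (A F) B = phi A (F B)] for every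
    rank one operator [F]. The products of rank one operators with operators of
    the algebra are of the same kind, and no nonzero operator annihilates all
    rank one operators, on either side; from this a formal computation
    ([exchangeable_ideal_derivation]) shows that
    [d A = delta A - delta 1 * A] is a derivation and that
    [tau B = B * tau 1 + d B]. Then [gamma A = delta A + A * tau 1] satisfies the
    ternary identity, and it is the only candidate, as one sees at [B = 1].

    It remains to see that [d] is inner, [d A = A * S - S * A]
    ([derivation_inner]); then [gamma A = (delta 1 - S) * A + A * (S + tau 1)].
    Continuity of [d] is not assumed, but it follows from the closed graph
    theorem on the nest algebra ([derivation_bounded]). On a member [M] with
    [M_- <> X], choose a functional [f] that vanishes on [M_-] and [y] with
    [f y = 1]; then [S x = - d (x (x) f) y], where [x (x) f] is the rank one
    operator [rank_one x f], implements [d] on [M]. Implementers on different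
    members differ by scalars where they meet and are uniformly bounded. Once
    normalised, they glue to a bounded operator on a dense subspace, and its
    extension to [X] is the operator [S].

    The functional analysis needed, over real and complex scalars alike, is the
    separation of points from closed subspaces by functionals
    ([Hahn_Banach_separation]) and the closed graph theorem ([closed_graph]),
    which is applied to [X] for the projections and to the nest algebra for
    [d]. *)

(** * The real Hahn-Banach theorem *)

Section RealHahnBanach.
Context {R : realType} {V : lmodType R}.
Implicit Types (p q : V -> R) (v x y : V).

Definition sublinear q : Prop :=
  (forall x y, q (x + y) <= q x + q y) /\
  (forall (t : R) x, 0 < t -> q (t *: x) <= t * q x).

Lemma sublinear0 q : sublinear q -> q 0 = 0.
Proof.
move=> [_ qZ]; have := qZ 2 0 (ltr0n _ 2); have := qZ 2^-1 0.
by rewrite !scaler0 invr_gt0 => /(_ (ltr0n _ 2)); lra.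
Qed.

Lemma sublinear_geN q x : sublinear q -> - q (- x) <= q x.
Proof.
by move=> sq; have := sq.1 x (- x); rewrite subrr sublinear0//; lra.
Qed.

(** This covers the two infima needed below: that of the translates of one
    functional and that of a chain of functionals. The translates themselves are
    not sublinear; it is enough that the inequalities hold between suitable
    members of the family. *)
Lemma inf_sublinear (I : Type) (D : set I) (g : I -> V -> R) (lb : V -> R) :
  D !=set0 -> (forall i x, D i -> lb x <= g i x) ->
  (forall i j x y, D i -> D j ->
    exists2 k, D k & g k (x + y) <= g i x + g j y) ->
  (forall i t x, D i -> 0 < t -> exists2 k, D k & g k (t *: x) <= t * g i x) ->
  let h x := inf [set g i x | i in D] in
  sublinear h /\ (forall i x, D i -> h x <= g i x).
Proof.
move=> [i0 Di0] glb gD gZ h.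
have hle i x : D i -> h x <= g i x.
  move=> Di; apply: ge_inf; last by exists i.
  by exists (lb x) => _ [j Dj <-]; exact: glb.
have hge c x : (forall i, D i -> c <= g i x) -> c <= h x.
  move=> ci; apply: lb_le_inf; first by exists (g i0 x); exists i0.
  by move=> _ [j Dj <-]; exact: ci.
split=> //; split=> [x y|t x t0].
  rewrite -lerBlDr; apply: (hge) => i Di.
  rewrite lerBlDl -lerBlDr; apply: hge => j Dj.
  have [k Dk] := gD i j x y Di Dj; have := hle k (x + y) Dk; lra.
rewrite mulrC -ler_pdivrMr//; apply: hge => i Di.
rewrite ler_pdivrMr// mulrC; have [k Dk] := gZ i t x Di t0.
exact: le_trans (hle k (t *: x) Dk).
Qed.

(** [h] is the infimum of [q (x + t *: v) - t * q v] over [t >= 0]. When [q] is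
    minimal, [h = q] and the last inequality makes [q] superadditive; in any
    case that inequality at [x = - v] gives [h (- v) <= - q v], which pins the
    value at [v] of every functional below [h]. *)
Lemma sublinear_shift q v : sublinear q ->
  exists h, [/\ sublinear h, forall x, h x <= q x
              & forall x, h x <= q (x + v) - q v].
Proof.
move=> sq; have [qD qZ] := sq.
have [||||sh hle] := @inf_sublinear R [set t | 0 <= t]
    (fun t x => q (x + t *: v) - t * q v) (fun x => - q (- x)).
- by exists 0 => /=.
- move=> t x /=; rewrite le_eqVlt => /orP[/eqP <-|t0].
    by rewrite scale0r addr0 mul0r subr0; exact: sublinear_geN.
  have := qD (x + t *: v) (- x); rewrite addrC addKr => H.
  have := qZ t^-1 (t *: v); rewrite scalerA mulVf ?gt_eqF// scale1r invr_gt0.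
  move=> /(_ t0); rewrite mulrC ler_pdivlMr// mulrC; lra.
- move=> s t x y /= s0 t0; exists (s + t); first by rewrite /= addr_ge0.
  rewrite scalerDl addrACA mulrDl; have := qD (x + s *: v) (y + t *: v); lra.
- move=> s t x /= s0 t0; exists (t * s); first by rewrite /= mulr_ge0// ltW.
  by rewrite -scalerA -scalerDr -mulrA mulrBr lerB// qZ.
- eexists; split; first exact: sh.
    by move=> x; have := hle 0 x (lexx _); rewrite scale0r addr0 mul0r subr0.
  by move=> x; have := hle 1 x ler01; rewrite scale1r mul1r.
Qed.

Lemma minimal_sublinear_linear q : sublinear q ->
  (forall h, sublinear h -> (forall x, h x <= q x) -> forall x, q x <= h x) ->
  scalar q.
Proof.
move=> sq qmin; have [qD qZ] := sq.
have qDE x y : q (x + y) = q x + q y.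
  apply/eqP; rewrite eq_le qD /=.
  have [h [sh hq /(_ x) hv]] := sublinear_shift y sq.
  by have := qmin h sh hq x; lra.
have qN x : q (- x) = - q x.
  by have := qDE x (- x); rewrite subrr sublinear0//; lra.
have qZE t x : 0 < t -> q (t *: x) = t * q x.
  move=> t0; apply/eqP; rewrite eq_le qZ//= -[leRHS]opprK -qN -scalerN.
  by rewrite lerNr -mulrN -qN qZ.
move=> a x y; rewrite qDE; congr (_ + _).
have [a0|a0|->] := ltgtP a 0; last by rewrite scale0r mul0r sublinear0.
  by rewrite -[a]opprK scaleNr qN qZE ?mulNr// oppr_gt0.
exact: qZE.
Qed.

Lemma minimal_sublinear_exists p : sublinear p ->
  exists q, [/\ sublinear q, forall x, q x <= p x & forall h, sublinear h ->
    (forall x, h x <= q x) -> forall x, q x <= h x].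
Proof.
move=> sp; (* Zorn's lemma for the reverse pointwise order *)
pose P q := sublinear q /\ forall x, q x <= p x; pose T := {q : V -> R | P q}.
pose rel (q1 q2 : T) := `[< forall x, sval q2 x <= sval q1 x >].
have p0 : T by exists p.
have [||A totA|[q [sq qp]] qmin] := @ZL_preorder T p0 rel.
- by move=> t; apply/asboolP.
- move=> r s t /asboolP rs /asboolP st; apply/asboolP => x.
  exact: le_trans (rs x).
- have [[a0 Aa0]|A0] := pselect (A !=set0); last first.
    by exists p0 => s As; case: A0; exists s.
  have [||||sh hle] := @inf_sublinear T A (fun q : T => sval q) (fun x => - p (- x)).
  + by exists a0.
  + move=> [q [sq qp]] x _ /=; apply: le_trans (sublinear_geN x sq).
    by rewrite lerN2.
  + move=> i j x y Ai Aj; have [/asboolP ij|/asboolP ji] := totA _ _ Ai Aj.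
      exists j => //; apply: le_trans ((proj1 (svalP j)).1 x y) _.
      by rewrite lerD2r.
    exists i => //; apply: le_trans ((proj1 (svalP i)).1 x y) _.
    by rewrite lerD2l.
  + by move=> i t x Ai t0; exists i => //; exact: (proj1 (svalP i)).2.
  + have hp x : inf [set sval i x | i in A] <= p x.
      apply: le_trans (hle a0 x Aa0) _; exact: (proj2 (svalP a0)).
    by exists (exist P _ (conj sh hp)) => s As; apply/asboolP => x; exact: hle.
- exists q; split=> // h sh hq x.
  have hp y : h y <= p y := le_trans (hq y) (qp y).
  have := qmin (exist P h (conj sh hp)); rewrite /rel /=.
  by move=> /(_ (introT (asboolP _) hq))/asboolP.
Qed.

Theorem real_Hahn_Banach p v : sublinear p ->
  exists u, [/\ scalar u, forall x, u x <= p x & u v = p v].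
Proof.
move=> sp; have [h [sh hp hv]] := sublinear_shift v sp.
have [q [sq qh qmin]] := minimal_sublinear_exists sh.
have lq := minimal_sublinear_linear sq qmin; exists q; split=> //.
  by move=> x; exact: le_trans (hp x).
apply/eqP; rewrite eq_le (le_trans (qh v) (hp v)) /=.
have := hv (- v); rewrite addNr sublinear0// sub0r; have := qh (- v).
have := lq (-1) v 0; rewrite scaleN1r !addr0 sublinear0// addr0 => ->; lra.
Qed.

Definition seminorm (n : V -> R) : Prop :=
  (forall x y, n (x + y) <= n x + n y) /\
  (forall a x, n (a *: x) = `|a| * n x).

(** Hahn-Banach for the distance to [M], which is sublinear, vanishes on [M] and
    is positive at [v]. The vector [v - m] almost attains the norm of [u], which
    bounds a vector where [u] is 1 independently of [M]. *)
Lemma real_separation n (M : set V) v d : seminorm n ->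
  M 0 -> (forall a x y, M x -> M y -> M (a *: x + y)) ->
  0 < d -> (forall m, M m -> d <= n (v - m)) ->
  exists u, [/\ scalar u, forall x, u x <= n x, forall m, M m -> u m = 0
    & 0 < u v /\ exists2 m, M m & n (v - m) <= 2 * u v].
Proof.
move=> [nD nZ] M0 Mlin d0 dM.
have n0 : n 0 = 0 by have := nZ 0 0; rewrite scale0r normr0 mul0r.
have nN x : n (- x) = n x by rewrite -scaleN1r nZ normrN1 mul1r.
have nge x : 0 <= n x by have := nD x (- x); rewrite subrr n0 nN; lra.
have [||||sh hle] := @inf_sublinear V M (fun m x => n (x - m)) (fun=> 0).
- by exists 0.
- by move=> *; exact: nge.
- move=> i j x y Mi Mj; exists (i + j); first by have := Mlin 1 i j; rewrite scale1r; exact.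
  by rewrite opprD addrACA.
- move=> i t x Mi t0; exists (t *: i); first by have := Mlin t i 0; rewrite addr0; exact.
  by rewrite -scalerBr nZ gtr0_norm.
have [u [lu uh uv]] := real_Hahn_Banach v sh.
have u0 : u 0 = 0 by have := lu (-1) 0 0; rewrite scaler0 addr0; lra.
exists u; split=> //.
- by move=> x; apply: le_trans (uh x) _; have := hle 0 x M0; rewrite subr0.
- have um m : M m -> u m <= 0.
    by move=> Mm; have := hle m m Mm; rewrite subrr n0; exact: le_trans.
  move=> m Mm; apply/eqP; rewrite eq_le um//=.
  have := lu (-1) m 0; rewrite u0 !addr0 => E.
  by have := um (-1 *: m); rewrite E -[X in M X]addr0; move=> /(_ (Mlin _ _ _ Mm M0)); lra.
have uvd : d <= u v.
  rewrite uv; apply: lb_le_inf; first by exists (n (v - 0)); exists 0.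
  by move=> _ [m Mm <-]; exact: dM.
split; first exact: lt_le_trans uvd.
have [||_ [m Mm <-] lt_m] := @inf_adherent R [set n (v - i) | i in M] (u v).
- exact: lt_le_trans uvd.
- split; first by exists (n (v - 0)); exists 0.
  by exists 0 => _ [m Mm <-]; exact: nge.
- exists m => //; apply: ltW; move: lt_m; rewrite -uv; lra.
Qed.

End RealHahnBanach.

(** An alias, because the multiplication by real scalars must not compete with
    the complex one on the same type. *)
Definition realified (R : realType) (X : lmodType R[i]) : Type := X.

Section Realified.
Context (R : realType) (X : lmodType R[i]).
HB.instance Definition _ := GRing.Zmodule.on (realified X).

Let rscale (a : R) (x : realified X) : realified X := a%:C%C *: (x : X).

Fact rscaleA a b x : rscale a (rscale b x) = rscale (a * b) x.
Proof. by rewrite /rscale scalerA -rmorphM. Qed.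
Fact rscale1 : left_id 1 rscale.
Proof. by move=> x; rewrite /rscale scale1r. Qed.
Fact rscaleDr : right_distributive rscale +%R.
Proof. by move=> a x y; rewrite /rscale scalerDr. Qed.
Fact rscaleDl x : {morph rscale^~ x : a b / a + b}.
Proof. by move=> a b; rewrite /rscale rmorphD scalerDl. Qed.

HB.instance Definition _ := GRing.Zmodule_isLmodule.Build R (realified X)
  rscaleA rscale1 rscaleDr rscaleDl.

Lemma realified_scaleE (a : R) (x : X) : a *: (x : realified X) = a%:C%C *: x.
Proof. by []. Qed.
End Realified.

(** * Closed subspaces and their separation from points *)

Section Subspaces.
Context {K : numFieldType} {X : normedModType K}.
Implicit Types (M : set X).

Lemma closed_subspace0 M : closed_subspace M -> M 0.
Proof. by move=> [[M0 _] _]; exact: set_mem M0. Qed.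

Lemma closed_subspace_lin M a x y :
  closed_subspace M -> M x -> M y -> M (a *: x + y).
Proof.
by move=> [[_ Ml] _] Mx My; apply: set_mem; apply: Ml; apply: mem_set.
Qed.

Lemma closed_subspaceZ M a x : closed_subspace M -> M x -> M (a *: x).
Proof.
move=> cM Mx; rewrite -[_ *: _]addr0; apply: closed_subspace_lin => //.
exact: closed_subspace0.
Qed.

Lemma closed_subspaceB M x y : closed_subspace M -> M x -> M y -> M (x - y).
Proof.
move=> cM Mx My; rewrite -scaleN1r addrC; exact: closed_subspace_lin.
Qed.

Lemma closed_subspaceD M x y : closed_subspace M -> M x -> M y -> M (x + y).
Proof.
by move=> cM Mx My; rewrite -[x]scale1r; exact: closed_subspace_lin.
Qed.

Lemma closure_normP M x : closure M x <->
  (forall e : K, 0 < e -> exists2 y, M y & `|x - y| <= e).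
Proof.
split=> [clx e e0|H B /nbhs_ballP[e /= e0 eB]].
  have [y [My By]] := clx _ (nbhsx_ballx x e e0).
  by exists y => //; move: By; rewrite -ball_normE /= => /ltW.
have e20 : 0 < e / 2 by rewrite divr_gt0.
have [y My xy] := H _ e20; exists y; split=> //; apply: eB.
rewrite -ball_normE /=; apply: le_lt_trans xy _.
by rewrite ltr_pdivrMr// ltr_pMr// ltr1n.
Qed.

Lemma closed_subspace_approx M x : closed_subspace M ->
  (forall e : K, 0 < e -> exists2 y, M y & `|x - y| <= e) -> M x.
Proof. by move=> [_ cM] /closure_normP; exact: cM. Qed.

Lemma closed_subspace_dist M v : closed_subspace M -> ~ M v ->
  exists2 d : K, 0 < d & forall m, M m -> d <= `|v - m|.
Proof.
move=> cM Mv; apply/not_exists2P => H; apply: Mv.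
apply: closed_subspace_approx => // e e0; have [//|] := H e.
move=> /existsNP[m /not_implyP[Mm /negP]]; rewrite -real_ltNge//; last first.
  exact: gtr0_real.
by move=> /ltW em; exists m.
Qed.

End Subspaces.

Section ComplexSeparation.
Context {R : realType} {X : normedModType R[i]}.
Local Open Scope complex_scope.

Lemma ge0_complexE (z : R[i]) : 0 <= z -> z = (complex.Re z)%:C.
Proof.
by move=> z0; rewrite [LHS]complexE (ger0_Im z0) mulr0 addr0.
Qed.

Lemma Re_norm_seminorm :
  seminorm (fun x : realified X => complex.Re `|x : X|).
Proof.
split=> [x y|a x].
  have := ler_normD (x : X) y; rewrite [`|x + y|]ge0_complexE//.
  by rewrite [`|x : X|]ge0_complexE// [`|y : X|]ge0_complexE// -rmorphD lecR.
rewrite realified_scaleE normrZ [`|x : X|]ge0_complexE//.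
by rewrite normc_def /= expr0n addr0 sqrtr_sqr; case: (`|x : X|) => ? ? /=; ring.
Qed.

(** A real functional [u] dominated by the norm is the real part of the complex
    functional [x |-> u x - i u (i x)], which is dominated by the norm too: the
    bound at [x] is the bound of [u] at the multiple of [x] by the phase that
    makes the value real. *)
Lemma complexify_functional (u : realified X -> R) :
  scalar u -> (forall x, u x <= complex.Re `|x : X|) ->
  let f (x : X) := u x +i* (- u ('i *: x)) in
  scalar f /\ forall x, `|f x| <= `|x|.
Proof.
move=> lu un f.
have uD x y : u (x + y) = u x + u y.
  by have := lu 1 x y; rewrite scale1r mul1r.
have u0 : u 0 = 0 by have := uD 0 0; rewrite addr0; lra.
have uZ (a : R) (x : X) : u (a%:C *: x) = a * u x.
  by have := lu a x 0; rewrite !addr0 u0 addr0.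
have uN (x : X) : u (- x) = - u x.
  by have := uZ (-1) x; rewrite rmorphN1 scaleN1r mulN1r.
have fZ a x : f (a *: x) = a * f x.
  case: a => a b; rewrite /f.
  have E : a +i* b = a%:C + b%:C * 'i by rewrite [LHS]complexE /= mulrC.
  have iE : 'i * (a +i* b) = a%:C * 'i - b%:C 
    by apply/eqP; rewrite eq_complex /=; apply/andP; split; apply/eqP; ring.
  rewrite scalerA iE {1}E !scalerDl -!scalerA scaleNr !uD uN !uZ.
  by apply/eqP; rewrite eq_complex /=; apply/andP; split; apply/eqP; ring.
have lf : scalar f.
  move=> a x y; rewrite -fZ /f scalerDr !uD.
  by apply/eqP; rewrite eq_complex /=; apply/andP; split; apply/eqP; ring.
split=> // x; have [->|fx0] := eqVneq (f x) 0; first by rewrite normr0.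
have nfx : `|f x| != 0 by rewrite normr_eq0.
have nc : `| `|f x| / f x| = 1 by rewrite normrM normrV ?unitfE// normr_id divff.
have E : f ((`|f x| / f x) *: x) = `|f x| by rewrite fZ divfK.
have := un ((`|f x| / f x) *: x); rewrite normrZ nc mul1r -lecR -ge0_complexE//.
by apply: le_trans; rewrite [leLHS]ge0_complexE// -{1}E.
Qed.

End ComplexSeparation.

(** The two scalar fields enter the proof only through the next two results:
    the archimedean property and the separation of a closed subspace from a
    point. *)
Lemma scalars_archimedean (K : numFieldType) : real_or_complex K ->
  forall x : K, exists n : nat, `|x| <= n%:R.
Proof.
case=> R x.
  by exists (Num.truncn `|x|).+1; rewrite ltW// truncnS_gt.
exists (Num.truncn (complex.Re `|x|)).+1.
by rewrite [leLHS]ge0_complexE// -(rmorph_nat (real_complex R)) lecR ltW// truncnS_gt.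
Qed.

(** The constant 2 stands for any bound above 1 on the norm of a vector on
    which [f] takes the value 1; it does not depend on [M]. *)
Theorem Hahn_Banach_separation (K : numFieldType) (X : normedModType K)
    (M : set X) (v : X) : real_or_complex K -> closed_subspace M -> ~ M v ->
  exists f : X -> K, [/\ scalar f, forall x, `|f x| <= `|x|,
    forall m, M m -> f m = 0, f v != 0 & exists2 y, f y = 1 & `|y| <= 2].
Proof.
move=> hK; case: hK X M v => R X M v cM Mv.
  have [d d0 dM] := closed_subspace_dist cM Mv.
  have [|||u [lu un uM [uv [m Mm vm]]]] :=
    @real_separation R X (fun x => `|x|) M v d _ _ _ d0 dM.
  - by split=> *; rewrite ?normrZ// ler_normD.
  - exact: closed_subspace0.
  - by move=> *; exact: closed_subspace_lin.
  have u0 : u 0 = 0 by have := lu (-1) 0 0; rewrite scaler0 addr0; lra.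
  have uN x : u (- x) = - u x by have := lu (-1) x 0; rewrite u0 !addr0 scaleN1r mulN1r.
  exists u; split=> //; first 1 last.
  - by rewrite gt_eqF.
  - exists ((u v)^-1 *: (v - m)).
      rewrite -[_ *: _]addr0 lu u0 addr0 -[v in v - m]scale1r lu uN (uM m)// oppr0 addr0.
      by rewrite mul1r mulVf// gt_eqF.
    by rewrite normrZ gtr0_norm ?invr_gt0// mulrC ler_pdivrMr.
  - move=> x; rewrite ler_norml un andbT lerNl -uN.
    by apply: le_trans (un _) _; rewrite normrN.
have [d d0 dM] := closed_subspace_dist cM Mv.
have dE := ge0_complexE (ltW d0).
have [|||||u [lu un uM [uv [m Mm vm]]]] := @real_separation R (realified X)
    (fun x => complex.Re `|x : X|) M v (complex.Re d).
- exact: Re_norm_seminorm.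
- exact: closed_subspace0.
- by move=> *; exact: closed_subspace_lin.
- by rewrite -ltcR -dE.
- by move=> x Mx; rewrite -lecR -dE -ge0_complexE// dM.
have [lf fn] := complexify_functional lu un.
set f := fun x : X => _ in lf fn.
have f0 : f 0 = 0.
  by apply: (addrI (f 0)); have := lf 1 0 0; rewrite scaler0 mul1r => <-; rewrite !addr0.
have fm x : M x -> f x = 0.
  by move=> Mx; rewrite /f !uM ?oppr0//; exact: closed_subspaceZ.
have fv : f v != 0 by rewrite eq_complex /= gt_eqF.
exists f; split=> //.
exists ((f v)^-1 *: (v - m)).
  rewrite -[_ *: _]addr0 lf f0 addr0 -scaleN1r addrC lf (fm m)//.
  by rewrite mulr0 add0r mulVf.
rewrite normrZ normrV ?unitfE// mulrC ler_pdivrMr ?normr_gt0//.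
rewrite [`|v - m|]ge0_complexE//.
apply: (@le_trans _ _ (2 * (u v)%:C%C)).
  by rewrite -(rmorph_nat (real_complex R)) -rmorphM lecR.
rewrite ler_pM2l ?ltr0n//; apply: le_trans (normc_ge_Re (f v)).
by rewrite lecR ler_norm.
Qed.

(** * The closed graph theorem *)

(** The closed balls around the origin of a complete norm. Describing a Banach
    space by them makes a space of operators one without the choice of a norm:
    its balls are given by bounds that the operators satisfy, and least bounds
    are never needed. Completeness is stated for sequences whose steps at least
    halve each time, since the radii of the steps after [n] then add up to at
    most [2 * r n]. *)
Record banach_balls (K : numFieldType) (E : lmodType K) (B : K -> set E) :
    Prop := BanachBalls {
  balls0 : forall r, 0 <= r -> B r 0;
  ballsD : forall r s x y, B r x -> B s y -> B (r + s) (x + y);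
  ballsZ : forall a r x, B r x -> B (`|a| * r) (a *: x);
  balls_absorb : forall x, exists n : nat, B n%:R x;
  balls_complete : forall (x : nat -> E) (r : nat -> K),
    (forall n, 0 <= r n) -> (forall n, r n.+1 <= r n / 2) ->
    (forall n, B (r n) (x n.+1 - x n)) ->
    exists y, forall n, B (2 * r n) (y - x n) }.

Section ClosedGraph.
Context {K : numFieldType}.
Hypothesis archK : forall x : K, exists n : nat, `|x| <= n%:R.

Lemma le_halving (r : nat -> K) n : (forall n, r n.+1 <= r n / 2) ->
  r n <= r 0%N / 2 ^+ n.
Proof.
move=> rS; elim: n => [|n IHn]; first by rewrite expr0 divr1.
apply: le_trans (rS n) _; rewrite exprSr invfM mulrA ler_pM2r//.
Qed.

Lemma small_pow2 (c e : K) : 0 <= c -> 0 < e -> exists n : nat, c / 2 ^+ n <= e.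
Proof.
move=> c0 e0; have [n cn] := archK (c / e); exists n.
rewrite ger0_norm ?divr_ge0// ?(ltW e0)// in cn.
rewrite ler_pdivrMr ?exprn_gt0// mulrC -ler_pdivrMr//; apply: le_trans cn _.
by rewrite -natrX ler_nat ltnW// ltn_expl.
Qed.

Lemma halving_small (r : nat -> K) e : (forall n, 0 <= r n) ->
  (forall n, r n.+1 <= r n / 2) -> 0 < e -> exists n, r n <= e.
Proof.
move=> r0 rS e0; have [n le_n] := small_pow2 (r0 0%N) e0; exists n.
exact: le_trans (le_halving n rS) le_n.
Qed.

Section Balls.
Context {E : lmodType K} {B : K -> set E} (gB : banach_balls B).

Lemma balls_le r s x : r <= s -> B r x -> B s x.
Proof.
move=> rs Bx; rewrite -[s](subrK r) -[x]add0r; apply: (ballsD gB) => //.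
by apply: (balls0 gB); rewrite subr_ge0.
Qed.

Lemma ballsN r x : B r x -> B r (- x).
Proof.
by move=> /(ballsZ gB (-1)); rewrite normrN1 mul1r scaleN1r.
Qed.

Lemma ballsB r s x y : B r x -> B s y -> B (r + s) (x - y).
Proof. by move=> Bx /ballsN; exact: (ballsD gB). Qed.
End Balls.

Lemma pos_le2 (a b : K) : 0 < a -> 0 < b ->
  exists c, [/\ 0 < c, c <= a & c <= b].
Proof.
move=> a0 b0; have := real_leP (gtr0_real a0) (gtr0_real b0).
by case=> [ab|/ltW ba]; [exists a|exists b].
Qed.

Section OpenCovering.
Context {E : lmodType K} {B : K -> set E} (gB : banach_balls B).

(** Baire's theorem for the closures of the sets [V k]. *)
Lemma balls_Baire (V : nat -> set E) : (forall x, exists k, V k x) ->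
  exists k w r, 0 < r /\ forall x, B r (x - w) ->
    forall e, 0 < e -> exists2 y, V k y & B e (x - y).
Proof.
move=> covV; apply: contrapT => H.
(* otherwise nested balls avoid [V 0], [V 1] and so on, one after the other *)
have step (q : nat * (E * K)) : exists p : E * K, 0 < q.2.2 ->
    [/\ B q.2.2 (p.1 - q.2.1), 0 < p.2, p.2 <= q.2.2 / 2 &
        forall x, B (2 * p.2) (x - p.1) -> ~ V q.1 x].
  case: q => k [w r] /=; have [r0|/negP nr0] := boolP (0 < r); last first.
    by exists (w, r) => r0; case: nr0.
  (* the radius is halved twice: for [balls_complete] and so that the limit of
     the centres stays in the ball that avoids [V k] *)
  suff [w' [e [Bw' e0 eV]]] : exists w' e, [/\ B r (w' - w), 0 < e &
      forall y, V k y -> ~ B e (w' - y)].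
    have e40 : 0 < e / 2 by rewrite divr_gt0.
    have r20 : 0 < r / 2 by rewrite divr_gt0.
    have [c [c0 ce cr]] := pos_le2 e40 r20; exists (w', c) => _; split=> //= x Bx Vx.
    apply: (eV x Vx); rewrite -opprB; apply: (ballsN gB).
    by apply: (balls_le gB) Bx; rewrite mulrC -ler_pdivlMr.
  apply: contrapT => H'; apply: H; exists k, w, r; split=> // x Bx e e0.
  apply: contrapT => Hy; apply: H'; exists x, e; split=> // y Vy By.
  by apply: Hy; exists y.
have [f fP] := choice step.
pose fix p n := if n is m.+1 then f (m, p m) else (0, 1).
have p0 n : 0 < (p n).2.
  by elim: n => [|n /(fP (n, p n))[]//]; exact: ltr01.
have pP n := fP (n, p n) (p0 n).
have [|||y yP] := @balls_complete _ _ _ gB (fun n => (p n).1) (fun n => (p n).2).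
- by move=> n; exact: ltW.
- by move=> n; have [] := pP n.
- by move=> n; have [] := pP n.
have [k Vk] := covV y; have [_ _ _ /(_ y (yP k.+1))] := pP k; exact.
Qed.
End OpenCovering.

Context {E F : lmodType K} {B : K -> set E} {C : K -> set F}.
Hypotheses (gB : banach_balls B) (gC : banach_balls C).
Context (T : {linear E -> F}).

(** By Baire's theorem some multiple of the preimage of the unit ball is dense
    in a ball. Hence every [x] is a sum of vectors at smaller and smaller scales
    with controlled images, and since the graph is closed, [T x] is the sum of
    these images. Closedness is only needed at the origin, by linearity. *)
Theorem closed_graph :
  (forall z, (forall e, 0 < e -> exists2 x, B e x & C e (T x - z)) -> z = 0) ->
  exists2 c, 0 <= c & forall s x, 0 < s -> B s x -> C (c * s) (T x).
Proof.
move=> closedT.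
have [k [w [r [r0 dense_r]]]] := @balls_Baire _ _ gB (fun k x => C k%:R (T x))
  (fun x => balls_absorb gC (T x)).
(* differences of two approximations move the centre from [w] to the origin *)
pose c := (k + k).+1%:R / r; have c0 : 0 < c by rewrite divr_gt0// ltr0n.
have near_ball s x : 0 < s -> B s x ->
    exists2 y, C (c * s) (T y) & B (s / 2) (x - y).
  move=> s0 Bx; have rs0 : 0 < r / s by rewrite divr_gt0.
  have Brx : B r ((r / s) *: x).
    have := ballsZ gB (r / s) Bx; rewrite gtr0_norm// divfK//.
    by rewrite gt_eqF.
  have r40 : 0 < r / 4 by rewrite divr_gt0.
  have [|y1 Ty1 By1] := dense_r ((r / s) *: x + w) _ (r / 4) r40.
    by rewrite addrK.
  have [|y2 Ty2 By2] := dense_r w _ (r / 4) r40.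
    by rewrite subrr; apply: (balls0 gB); exact: ltW.
  exists ((s / r) *: (y1 - y2)).
    rewrite linearZ linearB; have := ballsZ gC (s / r) (ballsB gC Ty1 Ty2).
    apply: (balls_le gC); rewrite gtr0_norm ?divr_gt0// /c -natrD.
    by rewrite [leLHS]mulrC [leRHS]mulrAC -[leRHS]mulrA ler_pM2r ?divr_gt0// ler_nat.
  have := ballsZ gB (s / r) (ballsB gB By1 By2).
  rewrite gtr0_norm ?divr_gt0// addrAC addrKA opprK.
  have -> : r / 4 + r / 4 = r / 2 by field.
  have -> : s / r * (r / 2) = s / 2 by field; rewrite gt_eqF.
  have <- : (s / r) *: ((r / s) *: x) = x.
    by rewrite scalerA mulrA divfK ?gt_eqF// divff ?gt_eqF// scale1r.
  by rewrite -scalerBr opprB addrA addrAC scalerA mulrA divfK ?gt_eqF//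
    divff ?gt_eqF// scale1r addrAC.
exists (2 * c); first by rewrite mulr_ge0// ltW.
move=> s x s0 Bx.
(* correct the remainder [u n] of [x] at every scale [sn n] *)
pose sn n := s / 2 ^+ n.
have sn0 n : 0 < sn n by rewrite divr_gt0// exprn_gt0.
have snS n : sn n.+1 = sn n / 2 by rewrite /sn exprSr invfM mulrA.
have step (q : nat * E) : exists y, B (sn q.1) q.2 ->
    C (c * sn q.1) (T y) /\ B (sn q.1 / 2) (q.2 - y).
  case: q => n u /=; have [Bu|nBu] := pselect (B (sn n) u); last by exists 0.
  by have [y Ty By] := near_ball (sn n) u (sn0 n) Bu; exists y.
have [f fP] := choice step.
pose fix u n := if n is m.+1 then u m - f (m, u m) else x.
have Bu n : B (sn n) (u n).
  elim: n => [|n /(fP (n, u n))[_]]; first by rewrite /sn expr0 divr1.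
  by rewrite snS.
have [|||z zP] := @balls_complete _ _ _ gC (fun n => T (x - u n)) (fun n => c * sn n).
- by move=> n; rewrite mulr_ge0// ltW.
- by move=> n; rewrite snS mulrA.
- move=> n; have [+ _] := fP (n, u n) (Bu n).
  by rewrite -linearB /= [x - (u n - _)]addrC addrKA opprK opprB subrK.
have Tx : T x - z = 0.
  apply: closedT => e e0.
  have [n ne] : exists n, 2 * (c + 1) * sn n <= e.
    have c20 : 0 <= 2 * (c + 1) * s by rewrite !mulr_ge0 ?addr_ge0// ltW.
    by have [n ne] := small_pow2 c20 e0; exists n; rewrite mulrA.
  exists (u n).
    apply: (balls_le gB) (Bu n); apply: le_trans ne; rewrite ler_peMl ?ltW//.
    by rewrite mulrDr mulr1 addrC -natr1 -addrA ltrDl addr_gt0// mulr_gt0.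
  have -> : T (u n) - (T x - z) = z - T (x - u n).
    by rewrite opprB linearB opprB addrCA.
  apply: (balls_le gC) (zP n); apply: le_trans ne; rewrite mulrA ler_pM2r//.
  by rewrite ler_pM2l// lerDl.
have := zP 0%N; rewrite subrr linear0 subr0 /sn expr0 divr1 mulrA.
by move/subr0_eq: Tx => ->.
Qed.

End ClosedGraph.

(** * The nest algebra as a Banach space *)

Section BanachBallInstances.
Context {K : numFieldType}.
Hypothesis archK : forall x : K, exists n : nat, `|x| <= n%:R.

Lemma le_real_eps (a b c : K) : 0 <= a -> 0 <= b -> 0 <= c ->
  (forall e, 0 < e -> a <= b + c * e) -> a <= b.
Proof.
move=> a0 b0 c0 H; have := real_leP (ger0_real a0) (ger0_real b0).
case=> // lt_ba; have ab0 : 0 < a - b by rewrite subr_gt0.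
have c1 : 0 < c + 1 by rewrite ltr_wpDl.
have := H ((a - b) / 2 / (c + 1)); rewrite !divr_gt0// => /(_ isT).
rewrite -lerBlDl mulrA ler_pdivlMr// mulrA.
have cc : c * (a - b) / 2 <= c * (a - b).
  by rewrite ler_pdivrMr// ler_peMr ?ler1n// mulr_ge0// ltW.
move=> /le_trans /(_ cc); rewrite mulrDr mulr1 mulrC gerDl.
by rewrite lt_geF.
Qed.

Lemma norm_small_eq0 (X : normedModType K) (x : X) (c : K) : 0 <= c ->
  (forall e, 0 < e -> `|x| <= c * e) -> x = 0.
Proof.
move=> c0 H; apply/eqP; rewrite -normr_le0; apply: (le_real_eps _ _ c0) => //.
by move=> e; rewrite add0r; exact: H.
Qed.

Lemma norm_banach_balls (X : completeNormedModType K) :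
  banach_balls (fun r => [set x : X | `|x| <= r]).
Proof.
split=> [r r0|r s x y /= xr ys|a r x /= xr|x|x r r0 rS xS] /=.
- by rewrite normr0.
- by apply: le_trans (ler_normD _ _) _; exact: lerD.
- by rewrite normrZ ler_wpM2l.
- have [n] := archK `|x|; rewrite normr_id => xn; by exists n.
have xD n k : `|x (k + n)%N - x n| <= 2 * r n - 2 * r (k + n)%N.
  elim: k => [|k IHk]; first by rewrite !subrr normr0.
  rewrite addSn; apply: le_trans (ler_distD (x (k + n)%N) _ _) _.
  apply: le_trans (lerD (xS _) IHk) _.
  rewrite addrCA lerD2l lerNr opprB.
  rewrite [2 * r (k + n)%N]mulr_natl mulr2n addrK.
  by rewrite mulrC -ler_pdivlMr.
have xd m n : (n <= m)%N -> `|x m - x n| <= 2 * r n.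
  move=> nm; rewrite -(subnK nm); apply: le_trans (xD _ _) _.
  by rewrite gerBl mulr_ge0.
have /cvg_ex[y xy] : cvg (x @ \oo).
  apply/cauchy_cvgP/cauchy_exP => e e0.
  have e40 : 0 < e / 4 by rewrite divr_gt0.
  have [n ne] := halving_small archK r0 rS e40.
  exists (x n), n => // m /= nm; rewrite -ball_normE /= distrC.
  apply: le_lt_trans (xd _ _ nm) _; rewrite mulrC -ltr_pdivlMr//.
  by apply: le_lt_trans ne _; rewrite ltr_pM2l// ltf_pV2 ?posrE// ltr_nat.
exists y => n; apply: (@le_real_eps _ _ 1) => //; first by rewrite mulr_ge0.
move=> e e0; rewrite mul1r.
have /cvgrPdist_le/(_ e e0)[m _ /(_ (maxn n m) (leq_maxr _ _)) /= ym] := xy.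
apply: le_trans (ler_distD (x (maxn n m)) _ _) _.
by rewrite addrC lerD// xd// leq_maxl.
Qed.
End BanachBallInstances.

Section NestAlgebraLinear.
Context {K : numFieldType} {X : normedModType K} {N : nest X}.

Lemma nest_closed M : nest_set N M -> closed_subspace M.
Proof. by move=> /(nest_closed_subspace (nestP N)). Qed.

Lemma nest_alg_linear (A : nest_alg N) : linear A.
Proof. by have [[]] := nest_algP A. Qed.

HB.instance Definition _ (A : nest_alg N) :=
  GRing.isLinear.Build K X X _ (nest_alg_val A) (nest_alg_linear A).

Lemma nest_alg_bound (A : nest_alg N) :
  exists2 c : K, 0 <= c & forall x, `|A x| <= c * `|x|.
Proof.
have [[_ [c cA]] _] := nest_algP A; exists `|c| => // x.
have c0 : 0 <= c * `|x| := le_trans (normr_ge0 _) (cA x).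
by apply: le_trans (cA x) _; rewrite -(ger0_norm c0) normrM normr_id.
Qed.

Lemma nest_alg_inv (A : nest_alg N) M x : nest_set N M -> M x -> M (A x).
Proof. by move=> NM Mx; have [_] := nest_algP A; apply; [exact: NM|exists x]. Qed.

Lemma nest_alg_exists (f : X -> X) (c : K) : linear f ->
  (forall x, `|f x| <= c * `|x|) ->
  (forall M x, nest_set N M -> M x -> M (f x)) -> exists A : nest_alg N, A =1 f.
Proof.
move=> lf cf inv.
have fN : in_nest_alg N f.
  apply/in_nest_algP; split; first by split=> //; exists c.
  by move=> M NM _ [x Mx <-]; exact: inv.
by exists (NestAlg fN).
Qed.

Lemma nest_alg_subE (A B : nest_alg N) x : (A - B) x = A x - B x.
Proof. by []. Qed.
End NestAlgebraLinear.

Lemma subr_telescope (V : zmodType) (u p q r s : V) :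
  u - (p + q) = u - (r + s) - (p - r) - (q - s).
Proof. by rewrite -[RHS]addrA -opprD addrACA -opprD opprB subrKA. Qed.

Section NestAlgebraBanach.
Context {K : numFieldType} {X : completeNormedModType K} {N : nest X}.
Hypothesis archK : forall x : K, exists n : nat, `|x| <= n%:R.

(** The limit of a sequence of operators is taken pointwise; it leaves the
    members of the nest invariant because they are closed. *)
Lemma nest_alg_banach_balls :
  banach_balls (fun r => [set A : nest_alg N | forall x, `|A x| <= r * `|x|]).
Proof.
split=> [r r0 x|r s A B Ar Bs x|a r A Ar x|A|A r r0 rS AS].
- by rewrite nest_alg_zeroE normr0 mulr_ge0.
- rewrite nest_alg_addE mulrDl; apply: le_trans (ler_normD _ _) _; exact: lerD.
- by rewrite nest_alg_scaleE normrZ -mulrA ler_wpM2l.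
- have [c c0 cA] := nest_alg_bound A; have [n cn] := archK c; exists n => x.
  apply: le_trans (cA x) _; rewrite ler_wpM2r//.
  by apply: le_trans cn; rewrite ger0_norm.
have lim x : exists y, forall n, `|y - A n x| <= 2 * (r n * `|x|).
  apply: (balls_complete (norm_banach_balls archK X)) => [n|n|n].
  - by rewrite mulr_ge0.
  - by rewrite mulrAC ler_wpM2r.
  - by have := AS n x.
have [f fA] := choice lim.
have lf : linear f.
  move=> a x y; apply: subr0_eq.
  apply: (@norm_small_eq0 _ _ _ (2 * (`|a *: x + y| + `|a| * `|x| + `|y|))).
    by rewrite mulr_ge0// !addr_ge0// mulr_ge0.
  move=> e e0; have [n ne] := halving_small archK r0 rS e0.
  have -> : f (a *: x + y) - (a *: f x + f y) = (f (a *: x + y) - A n (a *: x + y))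
       - a *: (f x - A n x) - (f y - A n y).
    by rewrite nest_alg_linear scalerBr; exact: subr_telescope.
  apply: le_trans (ler_normB _ _) _.
  apply: (@le_trans _ _ (2 * (r n * `|a *: x + y|) + `|a| * (2 * (r n * `|x|))
      + 2 * (r n * `|y|))).
    rewrite lerD//; apply: le_trans (ler_normB _ _) _.
    by rewrite lerD// normrZ ler_wpM2l.
  rewrite [X in X <= _](_ : _ = 2 * (`|a *: x + y| + `|a| * `|x| + `|y|) * r n).
    by rewrite ler_wpM2l// mulr_ge0// !addr_ge0// mulr_ge0.
  by ring.
have [c c0 cA] := nest_alg_bound (A 0%N).
have [|||B Bf] := @nest_alg_exists _ _ N f (2 * r 0%N + c).
- by [].
- move=> x; rewrite -[f x](subrK (A 0%N x)) mulrDl.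
  by apply: le_trans (ler_normD _ _) _; rewrite lerD// -mulrA.
- move=> M x NM Mx; apply: closed_subspace_approx.
    exact: nest_closed NM.
  move=> e e0; have x0 : 0 < 2 * `|x| + 1 by rewrite ltr_wpDl// mulr_ge0.
  have [n ne] := halving_small archK r0 rS (divr_gt0 e0 x0).
  exists (A n x); first exact: nest_alg_inv.
  apply: le_trans (fA x n) _; rewrite mulrCA.
  apply: (@le_trans _ _ (r n * (2 * `|x| + 1))); last by rewrite -ler_pdivlMr.
  by rewrite ler_wpM2l// lerDl.
exists B => n x; rewrite nest_alg_subE Bf; apply: le_trans (fA x n) _.
by rewrite mulrA.
Qed.
End NestAlgebraBanach.

(** * Nests *)

Section NestTheory.
Context {K : numFieldType} {X : normedModType K}.
Implicit Types (A L M : set X) (F : set (set X)) (x y v : X).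

Lemma closed_span_min A M : closed_subspace M -> A `<=` M ->
  closed_span A `<=` M.
Proof.
move=> cM AM; have -> : M = closure M by apply/closure_id; case: cM.
apply: closure_subset => _ [n [c [v [Av ->]]]].
elim/big_ind: _ => [|x y|i _]; first exact: closed_subspace0.
- exact: closed_subspaceD.
- by apply: closed_subspaceZ => //; exact: AM.
Qed.

Lemma subset_closed_span A : A `<=` closed_span A.
Proof.
move=> x Ax; apply: subset_closure; exists 1%N, (fun=> 1), (fun=> x).
by split=> //; rewrite big_ord1 scale1r.
Qed.

Context (N : nest X).

Lemma nest_total L M : nest_set N L -> nest_set N M ->
  L `<=` M \/ M `<=` L.
Proof. by move=> NL NM; have := nest_chain (nestP N) NL NM. Qed.

Lemma nest_total_lt L M x : nest_set N L -> nest_set N M -> L x -> ~ M x ->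
  M `<` L.
Proof.
move=> NL NM Lx Mx; rewrite properEneq; have [LM|ML] := nest_total NL NM.
  by case: Mx; exact: LM.
by split=> //; apply/eqP => E; apply: Mx; rewrite E.
Qed.

Lemma nest_union_lin F a x y : F `<=` nest_set N ->
  (\bigcup_(L in F) L) x -> (\bigcup_(L in F) L) y ->
  (\bigcup_(L in F) L) (a *: x + y).
Proof.
move=> FN [L FL Lx] [M FM My]; have [LM|ML] := nest_total (FN _ FL) (FN _ FM).
  exists M => //; apply: closed_subspace_lin (LM _ Lx) My.
  exact: nest_closed (FN _ FM).
exists L => //; apply: closed_subspace_lin Lx (ML _ My).
exact: nest_closed (FN _ FL).
Qed.

(** The union of a chain of subspaces is a subspace, so that it is dense in the
    closed span. *)
Lemma nest_join_approx F x (e : K) : F `<=` nest_set N -> F !=set0 ->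
  closed_span (\bigcup_(L in F) L) x -> 0 < e ->
  exists2 L, F L & exists2 y, L y & `|x - y| <= e.
Proof.
move=> FN [L0 FL0] /closure_normP H e0.
have U0 : (\bigcup_(L in F) L) 0.
  by exists L0 => //; exact: closed_subspace0 (nest_closed (FN _ FL0)).
have [_ [n [c [v [Uv ->]]]] xy] := H e e0.
suff [L FL Ly] : (\bigcup_(L in F) L) (\sum_(i < n) c i *: v i).
  by exists L => //; exists (\sum_(i < n) c i *: v i).
elim/big_ind: _ => [|y z Uy Uz|i _]; first exact: U0.
  by rewrite -[y]scale1r; exact: nest_union_lin.
by rewrite -[_ *: _]addr0; exact: nest_union_lin.
Qed.

Lemma nest_pred_nest M : nest_set N (nest_pred N M).
Proof. by apply: (nest_join (nestP N)) => L []. Qed.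

Lemma nest_pred_ge L M : nest_set N L -> L `<` M -> L `<=` nest_pred N M.
Proof.
by move=> NL LM x Lx; apply: subset_closed_span; exists L.
Qed.

Lemma nest_pred_min M L : closed_subspace L ->
  (forall L', nest_set N L' -> L' `<` M -> L' `<=` L) ->
  nest_pred N M `<=` L.
Proof.
move=> cL H; apply: closed_span_min => // x [L' [NL' L'M]]; exact: H.
Qed.

Lemma nest_pred_sub M : nest_set N M -> nest_pred N M `<=` M.
Proof.
move=> NM; apply: nest_pred_min; first exact: nest_closed NM.
by move=> L' _ [].
Qed.

Lemma nest_predS L M : nest_set N L -> nest_set N M -> L `<=` M ->
  nest_pred N L `<=` nest_pred N M.
Proof.
move=> NL NM LM; apply: nest_pred_min; first exact: nest_closed (nest_pred_nest M).
move=> L' NL' [L'L nLL']; apply: nest_pred_ge => //; split=> [x /L'L/LM//|ML'].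
by apply: nLL' => x /LM/ML'.
Qed.

(** A nonzero vector lies outside [L_-] for some nonzero member [L]: the least
    member [I] that contains it, or a member strictly between [0] and [I] when
    [I_- = I]. *)
Lemma nest_pred_separates w : w != 0 ->
  exists L, [/\ nest_set N L, (exists2 x, L x & x != 0) & ~ nest_pred N L w].
Proof.
move=> w0; pose I := \bigcap_(M in [set M | nest_set N M /\ M w]) M.
have NI : nest_set N I by apply: (nest_cap (nestP N)) => M [].
have Iw : I w by move=> M [].
have [Pw|] := pselect (nest_pred N I w); last by exists I; split=> //; exists w.
have [L [NL [LI nIL] [x Lx x0]]] :
    exists L, [/\ nest_set N L, L `<` I & exists2 x, L x & x != 0].
  apply: contrapT => H; have c0 : closed_subspace ([set 0] : set X).
    exact: nest_closed (nest_zero (nestP N)).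
  have /(_ w Pw) /= w00 : nest_pred N I `<=` [set 0].
    apply: nest_pred_min => // L NL LI x Lx; apply: contrapT => /eqP x0.
    by apply: H; exists L; split=> //; exists x.
  by rewrite w00 eqxx in w0.
exists L; split=> //; first by exists x.
move=> /(nest_pred_sub NL) Lw; apply: nIL; apply: bigcap_inf => //.
Qed.

(** A derivation will be implemented on [M] by means of a functional that
    vanishes on [M_-]; the vector of [M] outside [L_-] makes the implementer
    unique on [L] up to scalars. *)
Definition spanning L : Prop := exists M, [/\ nest_set N M, L `<=` M,
  (exists2 v, M v & ~ nest_pred N L v) & exists v, ~ nest_pred N M v].

(** If [X_- <> X], the whole space is spanning. Otherwise the proper members
    are dense and each has a larger proper member above it. *)
Lemma spanning_dense x (e : K) : (exists v : X, v != 0) -> 0 < e ->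
  exists L, [/\ nest_set N L, spanning L & exists2 y, L y & `|x - y| <= e].
Proof.
move=> [v0 v00] e0; have NT := nest_full (nestP N).
have [allX|] := pselect (forall v, nest_pred N setT v); last first.
  move=> /existsNP[v nv]; exists setT; split=> //.
    by exists setT; split=> //; [exists v|exists v].
  by exists x => //; rewrite subrr normr0 ltW.
have [||L [NL [_ TL]] [y Ly xy]] := nest_join_approx _ _ (allX x) e0.
- by move=> L [].
- exists [set 0]; split; first exact: nest_zero (nestP N).
  split=> // /(_ v0 I) /= v0E; by rewrite v0E eqxx in v00.
exists L; split=> //; last by exists y.
have [M [NM LM [_ TM]]] : exists M, [/\ nest_set N M, L `<` M & M `<` setT].
  apply: contrapT => H; apply: TL => z _.
  apply: (@nest_pred_min setT L (nest_closed NL) _ z (allX z)) => M NM MT.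
  have [ML//|LM] := nest_total NM NL.
  have [<-//|nLM] := pselect (L = M); exfalso; apply: H; exists M; split=> //.
  by rewrite properEneq; split=> //; apply/eqP.
exists M; split=> //.
- by case: LM.
- case: LM => _ /existsNP[v /not_implyP[Mv Lv]]; exists v => //.
  by move=> /(nest_pred_sub NL).
- have /existsNP[v /not_implyP[_ Mv]] := TM.
  by exists v => /(nest_pred_sub NM).
Qed.

End NestTheory.

(** * Rank one operators of the nest algebra *)

Section Functionals.
Context {K : numFieldType} {X : normedModType K}.
Implicit Types (f g : X -> K).

Definition bounded_functional f : Prop :=
  scalar f /\ exists2 c : K, 0 <= c & forall x, `|f x| <= c * `|x|.

Lemma functionalZ f a x : bounded_functional f -> f (a *: x) = a * f x.
Proof.
move=> [lf _]; have f0 : f 0 = 0.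
  by apply: (addrI (f 0)); rewrite addr0 -{1}[f 0]mul1r -lf scale1r addr0.
by have := lf a x 0; rewrite f0 !addr0.
Qed.

Lemma functionalD f x y : bounded_functional f -> f (x + y) = f x + f y.
Proof. by move=> [lf _]; rewrite -[x]scale1r lf scale1r mul1r. Qed.

Lemma functionalB f x y : bounded_functional f -> f (x - y) = f x - f y.
Proof.
by move=> bf; rewrite functionalD// -scaleN1r functionalZ// mulN1r.
Qed.

Lemma bounded_functional_comb a f g : bounded_functional f ->
  bounded_functional g -> bounded_functional (fun x => a * f x + g x).
Proof.
move=> [lf [c c0 fc]] [lg [d d0 gd]]; split=> [b x y|].
  by rewrite lf lg; ring.
exists (`|a| * c + d); first by rewrite addr_ge0// mulr_ge0.
move=> x; rewrite mulrDl -mulrA; apply: le_trans (ler_normD _ _) _.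
by rewrite lerD// normrM ler_wpM2l.
Qed.

Lemma bounded_functional_comp f (N : nest X) (A : nest_alg N) :
  bounded_functional f -> bounded_functional (f \o A).
Proof.
move=> [lf [c c0 fc]]; have [d d0 Ad] := nest_alg_bound A; split=> [a x y|] /=.
  by rewrite nest_alg_linear lf.
exists (c * d); first exact: mulr_ge0.
by move=> x; apply: le_trans (fc _) _; rewrite -mulrA ler_wpM2l.
Qed.

Lemma separation_functional (M : set X) v : real_or_complex K ->
  closed_subspace M -> ~ M v -> exists f,
    [/\ bounded_functional f, forall x, `|f x| <= `|x|, forall m, M m -> f m = 0,
        f v != 0 & exists2 y, f y = 1 & `|y| <= 2].
Proof.
move=> hK cM Mv; have [f [lf f1 fM fv fy]] := Hahn_Banach_separation hK cM Mv.
by exists f; split=> //; split=> //; exists 1 => // x; rewrite mul1r.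
Qed.

End Functionals.

Section RankOne.
Context {K : numFieldType} {X : normedModType K} {N : nest X}.
Implicit Types (f g : X -> K) (x y : X) (L M : set X).

(** The condition on [(x, f)] makes [y |-> f y *: x] leave the nest invariant: a
    member that does not contain [x] lies strictly below [L], hence in [L_-],
    where [f] vanishes. *)
Definition rank_one_pair x f : Prop := bounded_functional f /\
  exists L, [/\ nest_set N L, L x & forall m, nest_pred N L m -> f m = 0].

(** A total function with the junk value 0, so that the pairs need not be
    carried around in types. *)
Definition rank_one x f : nest_alg N := insubd 0 (fun y => f y *: x).

Lemma rank_oneE x f : rank_one_pair x f ->
  forall y, rank_one x f y = f y *: x.
Proof.
move=> [bf [L [NL Lx fL]]] y; have [lf [c c0 fc]] := bf.
suff H : in_nest_alg N (fun y => f y *: x).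
  by have /(congr1 (fun h : X -> X => h y)) := insubdK (0 : nest_alg N) H.
apply/in_nest_algP; split.
  split=> [a u v|]; first by rewrite lf scalerDl scalerA.
  by exists (c * `|x|) => z; rewrite normrZ mulrAC ler_wpM2r.
move=> M NM _ [z Mz <-]; have [Mx|nMx] := pselect (M x).
  exact: closed_subspaceZ (nest_closed NM) Mx.
rewrite fL ?scale0r; first exact: closed_subspace0 (nest_closed NM).
by apply: nest_pred_ge Mz => //; exact: nest_total_lt NL NM Lx nMx.
Qed.

Lemma rank_one_pairM (A : nest_alg N) x f :
  rank_one_pair x f -> rank_one_pair (A x) f.
Proof.
move=> [bf [L [NL Lx fL]]]; split=> //; exists L; split=> //.
exact: nest_alg_inv.
Qed.

Lemma rank_one_pair_comp (A : nest_alg N) x f :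
  rank_one_pair x f -> rank_one_pair x (f \o A).
Proof.
move=> [bf [L [NL Lx fL]]]; split; first exact: bounded_functional_comp.
exists L; split=> // m Lm; apply: fL; apply: nest_alg_inv Lm.
exact: nest_pred_nest.
Qed.

Lemma mul_rank_one (A : nest_alg N) x f : rank_one_pair x f ->
  A * rank_one x f = rank_one (A x) f.
Proof.
move=> xf; apply: nest_alg_ext => y.
by rewrite nest_alg_mulE !rank_oneE ?linearZ//; exact: rank_one_pairM.
Qed.

Lemma rank_one_mul (A : nest_alg N) x f : rank_one_pair x f ->
  rank_one x f * A = rank_one x (f \o A).
Proof.
move=> xf; apply: nest_alg_ext => y.
by rewrite nest_alg_mulE !rank_oneE//; exact: rank_one_pair_comp.
Qed.

Hypothesis hK : real_or_complex K.

Lemma rank_one_separates w : w != 0 ->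
  exists x f, [/\ rank_one_pair x f, x != 0 & f w != 0].
Proof.
move=> /(nest_pred_separates N)[L [NL [x Lx x0] Lw]].
have [f [bf _ fL fw _]] := separation_functional hK
  (nest_closed (nest_pred_nest N L)) Lw.
by exists x, f; split=> //; split=> //; exists L.
Qed.

(** Enough functionals occur in rank one operators to separate points. *)
Lemma rank_one_right_faithful (A : nest_alg N) :
  (forall x f, rank_one_pair x f -> rank_one x f * A = 0) -> A = 0.
Proof.
move=> H; apply: nest_alg_ext => w; apply: contrapT => /eqP.
rewrite nest_alg_zeroE => /rank_one_separates[x [f [xf x0 fw]]].
have := congr1 (fun B : nest_alg N => B w) (H x f xf).
rewrite nest_alg_mulE nest_alg_zeroE rank_oneE// => /eqP.
by rewrite scaler_eq0 (negPf fw) (negPf x0).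
Qed.

Hypothesis X0 : exists v : X, v != 0.

Lemma nest_alg_dense_eq0 (A : nest_alg N) :
  (forall L x, nest_set N L -> spanning N L -> L x -> A x = 0) -> A = 0.
Proof.
move=> H; apply: nest_alg_ext => x; rewrite nest_alg_zeroE.
have [c c0 Ac] := nest_alg_bound A; apply: (norm_small_eq0 c0) => e e0.
have [L [NL sL [y Ly xy]]] := spanning_dense N x X0 e0.
rewrite -[A x]subr0 -(H L y NL sL Ly) -linearB; apply: le_trans (Ac _) _.
by rewrite ler_wpM2l.
Qed.

Lemma spanning_pair L : spanning N L -> exists f y,
  f y = 1 /\ forall x, L x -> nest_set N L -> rank_one_pair x f.
Proof.
move=> [M [NM LM [v Mv Lv] _]].
have [f [bf _ fL _ [y fy _]]] := separation_functional hK
  (nest_closed (nest_pred_nest N L)) Lv.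
by exists f, y; split=> // x Lx NL; split=> //; exists L.
Qed.

(** The vectors that occur in nonzero rank one operators are dense. *)
Lemma rank_one_left_faithful (A : nest_alg N) :
  (forall x f, rank_one_pair x f -> A * rank_one x f = 0) -> A = 0.
Proof.
move=> H; apply: nest_alg_dense_eq0 => L x NL /spanning_pair[f [y [fy xf]]] Lx.
have := congr1 (fun B : nest_alg N => B y) (H x f (xf x Lx NL)).
by rewrite nest_alg_mulE nest_alg_zeroE rank_oneE ?fy ?scale1r//; exact: xf.
Qed.

End RankOne.

(** * Bilinear forms that vanish on zero products *)

Section ZeroProducts.
Context {A : pzRingType} (delta tau : {additive A -> A}).
Implicit Types (a b e j : A).

Definition balanced_form a b : A := delta a * b + a * tau b.
Local Notation phi := balanced_form.

(** When [phi] depends on [a * b] only, everything is exchangeable; the ternary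
    derivation identity is of this kind. *)
Definition exchangeable j : Prop := forall a b, phi (a * j) b = phi a (j * b).

Lemma balanced_formBl a a' b : phi (a - a') b = phi a b - phi a' b.
Proof. by rewrite /phi raddfB !mulrBl opprD addrACA. Qed.

Lemma balanced_formBr a b b' : phi a (b - b') = phi a b - phi a b'.
Proof. by rewrite /phi raddfB !mulrBr opprD addrACA. Qed.

Lemma exchangeableB j j' :
  exchangeable j -> exchangeable j' -> exchangeable (j - j').
Proof.
move=> ej ej' a b.
by rewrite mulrBr mulrBl balanced_formBl balanced_formBr ej ej'.
Qed.

Lemma exchangeable0 : exchangeable 0.
Proof.
by move=> a b; rewrite mulr0 mul0r /phi !raddf0 !mul0r !mulr0.
Qed.

Lemma exchangeableN j : exchangeable j -> exchangeable (- j).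
Proof.
by move=> ej; rewrite -[- j]add0r; apply: exchangeableB => //; exact: exchangeable0.
Qed.

Lemma exchangeableD j j' :
  exchangeable j -> exchangeable j' -> exchangeable (j + j').
Proof.
by move=> ej ej'; rewrite -[j']opprK; apply: exchangeableB => //; exact: exchangeableN.
Qed.

(** The products [(a * e) * (b - e * b)] and [(a - a * e) * (e * b)] vanish. *)
Lemma exchangeable_idempotent e :
  (forall a b, a * b = 0 -> phi a b = 0) -> e * e = e -> exchangeable e.
Proof.
move=> zp ee a b.
have := zp (a * e) (b - e * b); rewrite mulrBr mulrA -[a * e * e]mulrA ee subrr.
move=> /(_ erefl); rewrite balanced_formBr => /subr0_eq ->.
have := zp (a - a * e) (e * b).
rewrite mulrBl [a * e * _]mulrA -[a * e * e]mulrA ee -mulrA subrr.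
by move=> /(_ erefl); rewrite balanced_formBl => /subr0_eq ->.
Qed.

(** Enough exchangeable elements make [a |-> delta a - delta 1 * a] a
    derivation: the Leibniz rule holds when the right factor is in the ideal,
    and both ways of evaluating it on [a * b * j] agree. *)
Lemma exchangeable_ideal_derivation (J : set A) :
  J `<=` exchangeable -> (forall a j, J j -> J (a * j)) ->
  (forall j a, J j -> J (j * a)) ->
  (forall a, (forall j, J j -> a * j = 0) -> a = 0) ->
  (forall a, (forall j, J j -> j * a = 0) -> a = 0) ->
  let D a := delta a - delta 1 * a in
  (forall a b, D (a * b) = D a * b + a * D b) /\
  (forall b, tau b = b * tau 1 + D b).
Proof.
move=> Jex JMl JMr faithl faithr D.
have DE a : D a = delta a - delta 1 * a by [].
clearbody D.
have Dj j : J j -> D j = tau j - j * tau 1.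
  move=> /Jex/(_ 1 1); rewrite /phi !(mulr1, mul1r) => /(canRL (addrK _)) E.
  by apply: (addrI (delta 1 * j)); rewrite DE addrCA subrr addr0 E addrA.
have Dlj a j : J j -> D (a * j) = D a * j + a * D j.
  move=> Jj; have := Jex j Jj a 1; rewrite /phi !mulr1 => /(canRL (addrK _)) E.
  rewrite (Dj j)// mulrBr !DE E mulrBl !mulrA -!addrA; congr (_ + _).
  rewrite addrA; exact: addrC.
have Dder a b : D (a * b) = D a * b + a * D b.
  apply: subr0_eq; apply: faithl => j Jj; apply/eqP; rewrite mulrBl subr_eq0.
  apply/eqP/(addIr (a * b * D j)); rewrite -(Dlj _ j)// -mulrA.
  rewrite (Dlj a (b * j)); last exact: JMl.
  by rewrite (Dlj b j)// mulrDr mulrDl !mulrA addrA.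
split; first exact: Dder.
move=> b; apply: subr0_eq; apply: faithr => j Jj.
have E1 : j * tau b = tau (j * b) - D j * b.
  have := Jex j Jj 1 b; rewrite /phi !mul1r => /(canRL (addKr _)) ->.
  by rewrite DE mulrBl opprB -!mulrA [LHS]addrC [delta 1 * _ + _]addrC -addrA.
have E2 : j * D b = tau (j * b) - j * b * tau 1 - D j * b.
  have := Dder j b; rewrite (Dj (j * b)); last exact: JMr.
  move=> ->.
  by rewrite addrC addKr.
apply/eqP; rewrite mulrBr mulrDr subr_eq0 E1 E2 mulrA.
by rewrite addrA [X in _ == X - _]addrC subrK.
Qed.
End ZeroProducts.

(** * Rank one operators are exchangeable *)

Section NestProjections.
Context {K : numFieldType} {X : completeNormedModType K} {N : nest X}.
Hypothesis archK : forall x : K, exists n : nat, `|x| <= n%:R.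

(** The projection is bounded by the closed graph theorem; a member below [M]
    is fixed pointwise and a member above [M] contains the range. *)
Lemma nest_projection (M : set X) : nest_set N M -> complemented M ->
  exists P : nest_alg N, (forall x, M (P x)) /\ (forall x, M x -> P x = x).
Proof.
move=> NM [L [cL ML0 MLT]]; have cM := nest_closed NM.
have decomp x : exists y, M y /\ L (x - y).
  have : [set x + y | x in M & y in L] x by rewrite MLT.
  by move=> [y My [z Lz <-]]; exists y; rewrite addrC addKr.
have [p pP] := choice decomp.
have pE x y : M y -> L (x - y) -> p x = y.
  move=> My Lxy; have [Mp Lp] := pP x; apply: subr0_eq.
  have : (M `&` L) (p x - y); last by rewrite ML0.
  split; first exact: closed_subspaceB.
  rewrite -(subrKA x) addrC -[p x - x]opprB; exact: closed_subspaceB.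
have lp : linear p.
  move=> a x y; have [[Mx Lx] [My Ly]] := (pP x, pP y).
  apply: pE; first exact: closed_subspace_lin.
  by rewrite opprD addrACA -scalerBr; exact: closed_subspace_lin.
pose q : {linear X -> X} := HB.pack p (GRing.isLinear.Build K X X _ p lp).
have gX := norm_banach_balls archK X.
have [|c c0 pc] := @closed_graph K archK X X _ _ gX gX q.
  move=> z zP.
  have Mz : M z.
    apply: closed_subspace_approx => // e /zP[x _ /= xz].
    by exists (p x); [have [] := pP x|rewrite distrC].
  have Lz : L z.
    apply: closed_subspace_approx => // e e0.
    have [|x /= xe xz] := zP (e / 2); first by rewrite divr_gt0.
    exists (p x - x).
      by rewrite -opprB -scaleN1r; apply: closed_subspaceZ => //; have [] := pP x.
    rewrite opprB addrCA -opprB; apply: le_trans (ler_normB _ _) _.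
    by rewrite [leRHS]splitr lerD.
  by have : (M `&` L) z by []; rewrite ML0.
have [|M' x NM' M'x|P PE] := @nest_alg_exists _ _ N p c lp.
- move=> x; have [->|x0] := eqVneq x 0; last by apply: pc; rewrite ?normr_gt0 /=.
  by rewrite (linear0 q : p 0 = 0) normr0 mulr0.
- have [MM'|M'M] := nest_total NM NM'; first by apply: MM'; have [] := pP x.
  rewrite (pE x x)//; first exact: M'M.
  by rewrite subrr; exact: closed_subspace0.
exists P; split=> x; rewrite PE; first by have [] := pP x.
by move=> Mx; apply: pE => //; rewrite subrr; exact: closed_subspace0.
Qed.

End NestProjections.

Section RankOneExchangeable.
Context {K : numFieldType} {X : completeNormedModType K} {N : nest X}.
Hypothesis hK : real_or_complex K.
Hypothesis hN : forall M : set X,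
  nest_set N M -> nest_pred N M = M -> complemented M.
Context (delta tau : {linear nest_alg N -> nest_alg N}).
Hypothesis zp : forall A B : nest_alg N,
  A * B = 0 -> delta A * B + A * tau B = 0.

Local Notation exch := (exchangeable delta tau).

Lemma exchangeableZ (a : K) (J : nest_alg N) : exch J -> exch (a *: J).
Proof.
move=> eJ A B; rewrite /balanced_form -nest_alg_scalerAr -!nest_alg_scalerAl.
have dZ C : delta (a *: C) = a *: delta C := linearZ_LR delta a C.
have tZ C : tau (a *: C) = a *: tau C := linearZ_LR tau a C.
rewrite /= dZ tZ -!nest_alg_scalerAl -!nest_alg_scalerAr -!scalerDr.
by congr (_ *: _); exact: eJ.
Qed.

(** Every rank one operator is a linear combination of idempotents of the nest
    algebra. If [f x <> 0] it is a multiple of one. If [L_- <> L], auxiliary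
    [y] in [L] and [g] vanishing on [L_-] with [g y <> 0] reduce to that case.
    If [L_- = L], the operator [F] has range in [L] and vanishes on [L], so that
    [P + F] is idempotent along with the projection [P] onto [L]. *)
Lemma rank_one_exchangeable (x : X) (f : X -> K) :
  rank_one_pair (N := N) x f -> exch (rank_one x f).
Proof.
have nz y g : rank_one_pair (N := N) y g -> g y != 0 -> exch (rank_one y g).
  move=> yg gy; rewrite -[rank_one y g](scalerK (invr_neq0 gy)) invrK.
  apply/exchangeableZ/exchangeable_idempotent => //.
  apply: nest_alg_ext => z; rewrite nest_alg_mulE !nest_alg_scaleE.
  rewrite linearZ /= !rank_oneE// functionalZ; last by case: yg.
  by rewrite !scalerA; congr (_ *: _); field.
move=> [bf [L [NL Lx fL]]].
have pairL y g : bounded_functional g -> (forall m, nest_pred N L m -> g m = 0) ->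
    L y -> rank_one_pair (N := N) y g.
  by move=> bg gL Ly; split=> //; exists L.
have addL y g h : bounded_functional g -> bounded_functional h ->
    (forall m, nest_pred N L m -> g m = 0) ->
    (forall m, nest_pred N L m -> h m = 0) -> L y -> exch (rank_one y g) ->
    exch (rank_one y (fun z => -1 * g z + h z)) -> exch (rank_one y h).
  move=> bg bh gL hL Ly eg egh.
  have -> : rank_one y h = rank_one y (fun z => -1 * g z + h z) + rank_one y g :> nest_alg N.
    apply: nest_alg_ext => z; rewrite nest_alg_addE !rank_oneE; try exact: pairL.
      by rewrite -scalerDl mulN1r addrAC addNr add0r.
    apply: pairL => //; first exact: bounded_functional_comb.
    by move=> m Lm; rewrite gL// hL// mulr0 addr0.
  exact: exchangeableD.
have [PL|] := pselect (nest_pred N L = L).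
  have [P [LP PL']] := nest_projection (scalars_archimedean hK) NL (hN NL PL).
  have PP : P * P = P by apply: nest_alg_ext => z; rewrite nest_alg_mulE PL'.
  have xf := pairL x f bf fL Lx.
  rewrite -[rank_one x f](addKr P) addrC; apply: exchangeableB; last first.
    exact: exchangeable_idempotent.
  apply: exchangeable_idempotent => //; rewrite mulrDl !mulrDr PP.
  rewrite mul_rank_one// PL'// rank_one_mul//.
  have -> : rank_one x (f \o P) = 0 :> nest_alg N.
    apply: nest_alg_ext => z; rewrite rank_oneE; last exact: rank_one_pair_comp.
    by rewrite /= fL ?scale0r// PL.
  have -> : rank_one x f * rank_one x f = 0 :> nest_alg N.
    apply: nest_alg_ext => z; rewrite nest_alg_mulE !rank_oneE//.
    by rewrite functionalZ// (fL x) ?PL// mulr0 scale0r.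
  by rewrite !addr0.
move=> nPL.
have [y Ly PLy] : exists2 y, L y & ~ nest_pred N L y.
  apply/not_exists2P => H; apply: nPL; apply/seteqP; split.
    exact: nest_pred_sub.
  by move=> y Ly; apply: contrapT => PLy; have [] := H y.
have [g [bg _ gL gy _]] := separation_functional hK
  (nest_closed (nest_pred_nest N L)) PLy.
have step h : bounded_functional h -> (forall m, nest_pred N L m -> h m = 0) ->
    h y != 0 -> exch (rank_one x h).
  move=> bh hL hy; have [hx|hx] := eqVneq (h x) 0; last by apply: nz => //; exact: pairL.
  have Lxy : L (x + y) by apply: closed_subspaceD => //; exact: nest_closed NL.
  have -> : rank_one x h = rank_one (x + y) h - rank_one y h :> nest_alg N.
    apply: nest_alg_ext => z; rewrite nest_alg_subE !rank_oneE; try exact: pairL.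
    by rewrite -scalerBr addrK.
  apply: exchangeableB; apply: nz => //; try exact: pairL.
  by rewrite functionalD// hx add0r.
have [fy|] := eqVneq (f y) 0; last exact: step.
apply: (addL x g f) => //; first exact: step.
apply: step.
- exact: bounded_functional_comb.
- by move=> m Lm; rewrite gL// fL// mulr0 addr0.
- by rewrite fy addr0 mulN1r oppr_eq0.
Qed.

End RankOneExchangeable.

(** * Extension of bounded operators *)

(** The value at [x] is the point [z] with [`|z - S0 y| <= c * `|x - y|] for all
    [y] in [Y]; this property alone gives linearity and the bound. *)
Lemma bounded_extension (K : numFieldType) (X : normedModType K)
    (Z : completeNormedModType K) (Y : set X) (S0 : X -> Z) (c : K) :
  (forall x : K, exists n : nat, `|x| <= n%:R) ->
  (forall a x y, Y x -> Y y -> Y (a *: x + y)) ->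
  (forall x (e : K), 0 < e -> exists2 y, Y y & `|x - y| <= e) ->
  (forall a x y, Y x -> Y y -> S0 (a *: x + y) = a *: S0 x + S0 y) ->
  0 <= c -> (forall y, Y y -> `|S0 y| <= c * `|y|) ->
  exists S : X -> Z, [/\ linear S, forall x, `|S x| <= c * `|x|
                       & forall y, Y y -> S y = S0 y].
Proof.
move=> archK Ylin Yd Slin c0 Sc.
have YB x y : Y x -> Y y -> Y (y - x).
  by move=> Yx Yy; rewrite addrC -scaleN1r; exact: Ylin.
have SB x y : Y x -> Y y -> S0 (y - x) = S0 y - S0 x.
  by move=> Yx Yy; rewrite addrC -scaleN1r Slin// scaleN1r addrC.
have [y0 Yy0 _] := Yd 0 1 ltr01.
have Y0 : Y 0 by rewrite -(subrr y0); exact: YB.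
have S00 : S0 0 = 0 by rewrite -(subrr y0) SB// subrr.
have ext x : exists z, forall y, Y y -> `|z - S0 y| <= c * `|x - y|.
  have [|u uP] := @choice _ _ (fun n u => Y u /\ `|x - u| <= 1 / 2 ^+ n).
    by move=> n; have [|u Yu xu] := Yd x (1 / 2 ^+ n); [rewrite divr_gt0// exprn_gt0|exists u].
  have pow_ge0 n : 0 <= 1 / 2 ^+ n :> K by rewrite divr_ge0// exprn_ge0.
  have powS n : 1 / 2 ^+ n.+1 = 1 / 2 ^+ n / 2 :> K by rewrite exprSr invfM mulrA.
  have [|||z zP] := @balls_complete _ _ _ (norm_banach_balls archK Z)
      (S0 \o u) (fun n => 2 * c * (1 / 2 ^+ n)).
  - by move=> n; rewrite !mulr_ge0.
  - by move=> n; rewrite powS mulrA.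
  - move=> n /=; have [[Yn xn] [Yn1 xn1]] := (uP n, uP n.+1).
    rewrite -SB//; apply: le_trans (Sc _ (YB _ _ Yn Yn1)) _.
    rewrite [2 * c]mulrC -mulrA ler_wpM2l// mulr_natl mulr2n.
    apply: le_trans (ler_distD x _ _) _; rewrite lerD//.
    rewrite distrC; apply: le_trans xn1 _; rewrite powS ler_pdivrMr//.
    by rewrite ler_peMr// ler1n.
  exists z => y Yy.
  apply: (@le_real_eps K _ _ (5 * c)); rewrite ?mulr_ge0//.
  move=> e e0; have [n ne] := small_pow2 archK ler01 e0.
  have [Yn xn] := uP n; have /= zn := zP n.
  apply: le_trans (ler_distD (S0 (u n)) _ _) _.
  apply: (@le_trans _ _ (2 * (2 * c * (1 / 2 ^+ n)) + c * (1 / 2 ^+ n + `|x - y|))).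
    rewrite lerD// -SB//; apply: le_trans (Sc _ (YB _ _ Yy Yn)) _.
    rewrite ler_wpM2l//; apply: le_trans (ler_distD x _ _) _.
    by rewrite lerD// distrC.
  rewrite (_ : _ + _ = c * `|x - y| + 5 * c * (1 / 2 ^+ n)); last by ring.
  by rewrite lerD2l ler_wpM2l// mulr_ge0.
have [S SP] := choice ext.
exists S; split.
- move=> a x y; apply: subr0_eq.
  apply: (@norm_small_eq0 _ _ _ (2 * c * (`|a| + 1))).
    by rewrite !mulr_ge0// addr_ge0.
  move=> e e0; have [[u Yu xu] [v Yv yv]] := (Yd x e e0, Yd y e e0).
  rewrite (subr_telescope _ _ _ (a *: S0 u) (S0 v)) -Slin//.
  apply: (@le_trans _ _ (c * (`|a| * e + e) + `|a| * (c * e) + c * e)); last first.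
    by rewrite (_ : _ + _ + _ = 2 * c * (`|a| + 1) * e)//; ring.
  apply: le_trans (ler_normB _ _) _; rewrite lerD//; last first.
    by apply: le_trans (SP y v Yv) _; rewrite ler_wpM2l.
  apply: le_trans (ler_normB _ _) _; rewrite lerD//; last first.
    rewrite -scalerBr normrZ ler_wpM2l//.
    by apply: le_trans (SP x u Yu) _; rewrite ler_wpM2l.
  apply: le_trans (SP _ _ (Ylin a u v Yu Yv)) _; rewrite ler_wpM2l//.
  rewrite opprD addrACA -scalerBr; apply: le_trans (ler_normD _ _) _.
  by rewrite lerD// normrZ ler_wpM2l.
- by move=> x; have := SP x 0 Y0; rewrite S00 !subr0.
- move=> y Yy; apply: subr0_eq; apply/eqP; rewrite -normr_le0.
  by have := SP y y Yy; rewrite subrr normr0 mulr0.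
Qed.

(** * Derivations of a nest algebra are bounded *)

Section Derivations.
Context {K : numFieldType} {X : completeNormedModType K} {N : nest X}.
Hypothesis hK : real_or_complex K.
Hypothesis hN : forall M : set X,
  nest_set N M -> nest_pred N M = M -> complemented M.
Hypothesis X0 : exists v : X, v != 0.
Context (D : {linear nest_alg N -> nest_alg N}).
Hypothesis derD : forall A B, D (A * B) = D A * B + A * D B.

Let archK := scalars_archimedean hK.

(** If [A_n] tends to 0 and [D A_n] to [Z], sandwich between rank one operators
    [F] and [G]: [F * A_n * G] is a scalar that tends to 0 times a fixed
    operator, so that its image under [D] tends to 0; by the Leibniz rule that
    image tends to [F * Z * G]. *)
Lemma derivation_closable (Z : nest_alg N) :
  (forall e, 0 < e -> exists2 A : nest_alg N, (forall x, `|A x| <= e * `|x|) &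
     forall x, `|(D A - Z) x| <= e * `|x|) -> Z = 0.
Proof.
move=> HZ; apply: (nest_alg_dense_eq0 X0) => M y NM sM My.
have [g [z [gz Mg]]] := spanning_pair hK sM.
apply: contrapT => /eqP /(rank_one_separates (N := N) hK)[x [f [xf x0 fZ]]].
have Mx : M x.
  have [_ [L [NL Lx fL]]] := xf; have [LM|ML] := nest_total NL NM; first exact: LM.
  apply: contrapT => nMx; case/eqP: fZ; apply: fL.
  apply: (nest_pred_ge NM (nest_total_lt NL NM Lx nMx)).
  exact: nest_alg_inv.
have [xg yg] := (Mg x Mx NM, Mg y My NM).
set F : nest_alg N := rank_one x f; set G : nest_alg N := rank_one y g.
set H : nest_alg N := rank_one x g.
have Gz : G z = y by rewrite rank_oneE// gz scale1r.
have key (A : nest_alg N) : f (D A y) *: x = f (A y) *: D H z - D F (A y) - F (A (D G z)).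
  have E : F * A * G = f (A y) *: H.
    apply: nest_alg_ext => u.
    rewrite !nest_alg_mulE nest_alg_scaleE !rank_oneE// linearZ functionalZ; last by case: xf.
    by rewrite scalerA mulrC.
  have := congr1 (fun B : nest_alg N => D B z) E.
  rewrite !derD linearZ nest_alg_addE !nest_alg_mulE nest_alg_addE Gz nest_alg_scaleE => <-.
  rewrite (nest_alg_mulE (D F) A) (nest_alg_mulE F (D A)) addrAC addrK [X in X - _]addrC addrK.
  by rewrite (rank_oneE xf).
have [bf _] := xf; have [_ [cf cf0 fc]] := bf.
have [a a0 Fa] := nest_alg_bound (D F); have [b b0 Fb] := nest_alg_bound F.
case/negP: fZ; suff /eqP : f (Z y) *: x = 0 by rewrite scaler_eq0 (negPf x0) orbF.
pose C := cf * `|y| * `|x| + cf * `|y| * `|D H z| + a * `|y| + b * `|D G z|.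
apply: (@norm_small_eq0 _ _ _ C); first by rewrite !addr_ge0// !mulr_ge0.
move=> e e0; have [A Ae DAe] := HZ e e0.
have -> : f (Z y) *: x = f (A y) *: D H z - D F (A y) - F (A (D G z)) - f ((D A - Z) y) *: x.
  by rewrite -key nest_alg_subE (functionalB _ _ bf) scalerBl opprB addrC subrK.
rewrite (_ : C * e = cf * (e * `|y|) * `|D H z| + a * (e * `|y|) + b * (e * `|D G z|)
     + cf * (e * `|y|) * `|x|); last by rewrite /C; ring.
apply: le_trans (ler_normB _ _) _; apply: lerD; last first.
  by rewrite normrZ ler_wpM2r//; apply: le_trans (fc _) _; rewrite ler_wpM2l.
apply: le_trans (ler_normB _ _) _; apply: lerD; last first.
  by apply: le_trans (Fb _) _; rewrite ler_wpM2l.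
apply: le_trans (ler_normB _ _) _; apply: lerD; last first.
  by apply: le_trans (Fa _) _; rewrite ler_wpM2l.
by rewrite normrZ ler_wpM2r//; apply: le_trans (fc _) _; rewrite ler_wpM2l.
Qed.

Lemma derivation_bounded : exists2 c : K, 0 <= c &
  forall (A : nest_alg N) s, 0 <= s -> (forall x, `|A x| <= s * `|x|) ->
  forall x, `|D A x| <= c * s * `|x|.
Proof.
have gA := nest_alg_banach_balls (N := N) archK.
have [|c c0 Dc] := @closed_graph K archK _ _ _ _ gA gA D.
  exact: derivation_closable.
exists c => // A s; rewrite le_eqVlt => /orP[/eqP <- A0 x|s0 As]; last exact: Dc.
have -> : A = 0.
  apply: nest_alg_ext => u; apply/eqP; rewrite nest_alg_zeroE -normr_le0.
  by have := A0 u; rewrite mul0r.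
by rewrite linear0 nest_alg_zeroE normr0 mulr0 mul0r.
Qed.

End Derivations.

Lemma scale_of_lin (K : numFieldType) (U V : lmodType K) (M : set U)
    (S : U -> V) :
  (forall a x y, M x -> M y -> S (a *: x + y) = a *: S x + S y) -> M 0 ->
  forall a x, M x -> S (a *: x) = a *: S x.
Proof.
move=> Sl M0 a x Mx; have E0 : S 0 = 0.
  by apply: (addrI (S 0)); rewrite addr0 -{1}[S 0]scale1r -Sl// scale1r addr0.
by have := Sl a x 0 Mx M0; rewrite E0 !addr0.
Qed.

Lemma subr_swap (V : zmodType) (p q r s : V) : p - q = r - s -> q - s = p - r.
Proof.
move=> /(canRL (subrK _)) ->.
by rewrite -[r - s + q]addrA [r + _]addrC addrK addrC.
Qed.

Lemma subrACA (V : zmodType) (p q r s : V) : p - q - (r - s) = p - r - (q - s).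
Proof. by rewrite !opprB [s - r]addrC addrACA [- q + s]addrC. Qed.

(** * Derivations of a nest algebra are inner *)

Section InnerDerivations.
Context {K : numFieldType} {X : completeNormedModType K} {N : nest X}.
Hypothesis hK : real_or_complex K.
Hypothesis hN : forall M : set X,
  nest_set N M -> nest_pred N M = M -> complemented M.
Hypothesis X0 : exists v : X, v != 0.
Context (D : {linear nest_alg N -> nest_alg N}).
Hypothesis derD : forall A B, D (A * B) = D A * B + A * D B.

Let archK := scalars_archimedean hK.

Section Implementers.
Context (x0 : X) (f0 : X -> K).
Hypotheses (bf0 : bounded_functional f0) (f0x0 : f0 x0 = 1).

(** Adding a scalar to [S] does not change the commutators; the last condition
    removes this freedom. *)
Definition implements (c : K) (M : set X) (S : X -> X) : Prop :=
  [/\ forall a x y, M x -> M y -> S (a *: x + y) = a *: S x + S y,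
      forall A x, M x -> D A x = A (S x) - S (A x),
      forall x, M x -> `|S x| <= c * `|x| & f0 (S x0) = 0].

(** With [f y = 1], the Leibniz rule for [A * rank_one x f] evaluated at [y] says
    that [x |-> - D (rank_one x f) y] implements [D]. The bound does not depend
    on [M], because those of [f] and [y] do not. *)
Lemma implementer_exists : exists2 c : K, 0 <= c & forall M,
  nest_set N M -> M x0 -> (exists v, ~ nest_pred N M v) ->
  exists S, implements c M S.
Proof.
have [c c0 Dc] := derivation_bounded hK X0 derD; have [_ [d d0 fd]] := bf0.
have f0Z a x : f0 (a *: x) = a * f0 x by exact: functionalZ.
exists (2 * c + d * (2 * c * `|x0|)); first by rewrite addr_ge0// !mulr_ge0.
move=> M NM Mx0 [v Mv].
have [f [bf f1 fM _ [y fy y2]]] := separation_functional hK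
  (nest_closed (nest_pred_nest N M)) Mv.
have xf x : M x -> rank_one_pair (N := N) x f by move=> Mx; split=> //; exists M.
pose T x := - D (rank_one x f) y.
have Tlin a x z : M x -> M z -> T (a *: x + z) = a *: T x + T z.
  move=> Mx Mz; rewrite /T.
  have -> : rank_one (a *: x + z) f = a *: rank_one x f + rank_one z f :> nest_alg N.
    apply: nest_alg_ext => u; rewrite nest_alg_addE nest_alg_scaleE !rank_oneE; try exact: xf.
      by rewrite scalerDr !scalerA mulrC.
    by apply: xf; apply: closed_subspace_lin => //; exact: nest_closed NM.
  by rewrite linearP nest_alg_addE nest_alg_scaleE opprD scalerN.
have TD A x : M x -> D A x = A (T x) - T (A x).
  move=> Mx; have Fy : (rank_one x f : nest_alg N) y = x.
    by rewrite (rank_oneE (xf x Mx)) fy scale1r.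
  have := congr1 (fun B : nest_alg N => D B y) (mul_rank_one A (xf x Mx)).
  rewrite derD nest_alg_addE !nest_alg_mulE Fy /T => <-.
  by rewrite linearN opprK addrC addrK.
have Tb x : M x -> `|T x| <= 2 * c * `|x|.
  move=> Mx; rewrite /T normrN.
  apply: (@le_trans _ _ (c * `|x| * `|y|)).
    apply: Dc => // u; rewrite (rank_oneE (xf x Mx)) normrZ mulrC.
    by rewrite ler_wpM2l.
  rewrite (_ : 2 * c * `|x| = c * `|x| * 2); last by ring.
  by rewrite ler_wpM2l// mulr_ge0.
exists (fun x => T x - f0 (T x0) *: x); split.
- move=> a x z Mx Mz; rewrite Tlin// scalerBr !scalerDr opprD addrACA.
  by rewrite !scalerA [_ * a]mulrC.
- by move=> A x Mx; rewrite TD// linearB linearZ /= opprB addrA subrK.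
- move=> x Mx; rewrite mulrDl; apply: le_trans (ler_normB _ _) _.
  rewrite lerD ?Tb// normrZ ler_wpM2r//; apply: le_trans (fd _) _.
  by rewrite ler_wpM2l// Tb.
- by rewrite (functionalB _ _ bf0) f0Z f0x0 mulr1 subrr.
Qed.

(** The difference [T] of two implementers commutes with the operators of the
    nest algebra; applied to [rank_one x g] at a vector where [g] does not
    vanish, this makes [T] scalar on [L], and the normalisation at [x0] makes
    the scalar zero. *)
Lemma implementer_unique c L M M' S S' v : nest_set N L ->
  L `<=` M -> L `<=` M' -> L x0 -> M v -> M' v -> ~ nest_pred N L v ->
  implements c M S -> implements c M' S' -> forall x, L x -> S' x = S x.
Proof.
move=> NL LM LM' Lx0 Mv M'v Lv [Sl SD _ S0] [Sl' SD' _ S0'].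
have [g [bg _ gL gv _]] := separation_functional hK
  (nest_closed (nest_pred_nest N L)) Lv.
have L_0 : L 0 by exact: closed_subspace0 (nest_closed NL).
have SZ := scale_of_lin Sl (LM _ L_0).
have SZ' := scale_of_lin Sl' (LM' _ L_0).
pose k := g (S' v - S v) / g v.
have Tk x : L x -> S' x - S x = k *: x.
  move=> Lx; have xg : rank_one_pair (N := N) x g by split=> //; exists L.
  have := SD (rank_one x g) v Mv; rewrite SD'// !(rank_oneE xg).
  rewrite SZ ?SZ'//; try by [exact: LM|exact: LM'].
  move=> E; have {}E : g v *: (S' x - S x) = g (S' v - S v) *: x.
    by rewrite scalerBr (functionalB _ _ bg) scalerBl; exact: subr_swap.
  by rewrite -[LHS]scale1r -(mulVf gv) -scalerA E scalerA mulrC.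
have : f0 (S' x0 - S x0) = 0 by rewrite (functionalB _ _ bf0) S0 S0' subrr.
rewrite Tk// functionalZ// f0x0 mulr1 => k0 x Lx; apply: subr0_eq.
by rewrite Tk// k0 scale0r.
Qed.

(** [s] is the value at [x] of an implementer on a member [M] large enough for
    [implementer_unique] to apply at [x]. *)
Definition local_value c x s : Prop := exists L M S, [/\ nest_set N L,
  nest_set N M, L `<=` M & [/\ exists2 v, M v & ~ nest_pred N L v, L x0, L x,
  implements c M S & s = S x]].

Lemma local_value_unique c x s s' :
  local_value c x s -> local_value c x s' -> s = s'.
Proof.
have half L L' M M' S S' : nest_set N L -> nest_set N L' -> nest_set N M ->
    nest_set N M' -> L `<=` M -> L' `<=` M' -> L `<=` L' ->
    (exists2 v, M v & ~ nest_pred N L v) ->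
    (exists2 v, M' v & ~ nest_pred N L' v) -> L x0 -> L x ->
    implements c M S -> implements c M' S' -> S' x = S x.
  move=> NL NL' NM NM' LM LM' LL' [v Mv Lv] [v' Mv' Lv'] Lx0 Lx iS iS'.
  have LM'2 : L `<=` M' by move=> u /LL'/LM'.
  have [MM'|M'M] := nest_total NM NM'.
    exact: (implementer_unique NL LM LM'2 Lx0 Mv (MM' _ Mv) Lv iS iS').
  apply: (implementer_unique NL LM LM'2 Lx0 (M'M _ Mv') Mv' _ iS iS') => //.
  by move=> /(nest_predS NL NL' LL').
move=> [L [M [S [NL NM LM [vM Lx0 Lx iS ->]]]]].
move=> [L' [M' [S' [NL' NM' LM' [vM' Lx0' Lx' iS' ->]]]]].
have [LL'|L'L] := nest_total NL NL'.
  by apply/esym; apply: (half L L' M M').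
by apply: (half L' L M' M).
Qed.

(** The local values form a bounded operator on the dense union of the spanning
    members, which extends to [X]. The extension leaves a member [M] invariant:
    for [x] in [M], the identity for the projection onto [M], or for
    [rank_one x f] with [f] vanishing on [M_-] but not on [M], expresses [S x]
    by vectors of [M]. *)
Lemma implementer_glued : (exists L, [/\ nest_set N L, spanning N L & L x0]) ->
  exists S : nest_alg N, forall A, D A = A * S - S * A.
Proof.
move=> [L0 [NL0 sL0 L0x0]].
have [c c0 impl] := implementer_exists.
have /choice[S0 S0P] x : exists s0, forall s, local_value c x s -> s0 = s.
  have [[s xs]|none] := pselect (exists s, local_value c x s).
    by exists s => s' xs'; exact: local_value_unique xs xs'.
  by exists 0 => s xs; case: none; exists s.
pose Y : set X := fun x => exists L, [/\ nest_set N L, spanning N L, L x0 & L x].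
have Yloc x y : Y x -> Y y -> exists L M S, [/\ nest_set N L, L `<=` M, L x & L y]
    /\ [/\ implements c M S, forall z, L z -> S0 z = S z & forall z, L z -> Y z].
  move=> [L1 [NL1 sL1 L1x0 L1x]] [L2 [NL2 sL2 L2x0 L2y]].
  have [L [NL sL Lx0 Lx Ly]] : exists L, [/\ nest_set N L, spanning N L, L x0, L x & L y].
    by have [L12|L21] := nest_total NL1 NL2; [exists L2|exists L1]; split=> //;
      [exact: L12|exact: L21].
  have [M [NM LM vM nM]] := sL.
  have [S iS] := impl M NM (LM _ Lx0) nM.
  exists L, M, S; split=> //; split=> //.
    by move=> z Lz; apply: S0P; exists L, M, S.
  by move=> z Lz; exists L.
have Yd x (e : K) : 0 < e -> exists2 y, Y y & `|x - y| <= e.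
  move=> e0; have [L [NL sL [y Ly xy]]] := spanning_dense N x X0 e0.
  exists y => //; have [LL0|L0L] := nest_total NL NL0.
    by exists L0; split=> //; exact: LL0.
  by exists L; split=> //; exact: L0L.
have [|||S [Sl Sb SY]] := @bounded_extension K X X Y S0 c archK _ Yd _ c0.
- move=> a x y Yx Yy; have [L [M [S [[NL LM Lx Ly] [_ _ LY]]]]] := Yloc x y Yx Yy.
  by apply: LY; apply: closed_subspace_lin => //; exact: nest_closed NL.
- move=> a x y Yx Yy; have [L [M [S [[NL LM Lx Ly] [[Sl _ _ _] S0E LY]]]]] := Yloc x y Yx Yy.
  rewrite !S0E//; first by apply: Sl; exact: LM.
  by apply: closed_subspace_lin => //; exact: nest_closed NL.
- move=> x Yx; have [L [M [S [[NL LM Lx _] [[_ _ Sb _] S0E _]]]]] := Yloc x x Yx Yx.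
  by rewrite S0E//; apply: Sb; exact: LM.
pose S' : {linear X -> X} := HB.pack S (GRing.isLinear.Build K X X _ S Sl).
have SB u w : S (u - w) = S u - S w by exact: (linearB S').
have SZ a u : S (a *: u) = a *: S u by exact: (linearZ_LR S').
have SD A x : D A x = A (S x) - S (A x).
  apply: subr0_eq; have [a a0 Aa] := nest_alg_bound A.
  have [b b0 Db] := nest_alg_bound (D A).
  apply: (@norm_small_eq0 _ _ _ (b + (a * c + c * a))).
    by rewrite !addr_ge0// mulr_ge0.
  move=> e e0; have [y Yy xy] := Yd x e e0.
  have SDy : D A y - (A (S y) - S (A y)) = 0.
    have [L [M [T [[NL LM Ly _] [[_ TD _ _] TE LY]]]]] := Yloc y y Yy Yy.
    have LAy : L (A y) by exact: nest_alg_inv.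
    by rewrite !SY ?TE//; [rewrite TD ?subrr//; exact: LM|exact: LY].
  rewrite -[X in `|X|]subr0 -SDy.
  have -> : D A x - (A (S x) - S (A x)) - (D A y - (A (S y) - S (A y))) =
     D A (x - y) - (A (S (x - y)) - S (A (x - y))).
    by rewrite SB (linearB (D A)) !(linearB A) SB subrACA [X in _ - X]subrACA.
  apply: le_trans (ler_normB _ _) _; rewrite mulrDl lerD//.
    by apply: le_trans (Db _) _; rewrite ler_wpM2l.
  apply: le_trans (ler_normB _ _) _; rewrite mulrDl lerD// -mulrA.
    apply: le_trans (Aa _) _; rewrite ler_wpM2l//.
    by apply: le_trans (Sb _) _; rewrite ler_wpM2l.
  apply: le_trans (Sb _) _; rewrite ler_wpM2l//.
  by apply: le_trans (Aa _) _; rewrite ler_wpM2l.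
have [|B BS] := @nest_alg_exists _ _ N S c Sl Sb.
  move=> M x NM Mx; have [PM|] := pselect (nest_pred N M = M).
    have [P [MP PM']] := nest_projection archK NM (hN NM PM).
    have := SD P x; rewrite (PM' x Mx) => /eqP; rewrite eq_sym subr_eq => /eqP E.
    have -> : S x = P (S x) - D P x by rewrite E addrC addKr.
    by apply: closed_subspaceB; [exact: nest_closed NM|exact: MP|exact: nest_alg_inv].
  move=> nPM; have [y My PMy] : exists2 y, M y & ~ nest_pred N M y.
    apply/not_exists2P => H; apply: nPM; apply/seteqP; split.
      exact: nest_pred_sub.
    by move=> y My; apply: contrapT => PMy; have [] := H y.
  have [f [bf _ fM fy _]] := separation_functional hK
    (nest_closed (nest_pred_nest N M)) PMy.
  have xf : rank_one_pair (N := N) x f by split=> //; exists M.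
  have := SD (rank_one x f) y; rewrite !(rank_oneE xf) SZ => E.
  have -> : S x = (f y)^-1 *: (f (S y) *: x - D (rank_one x f) y).
    by rewrite E opprB addrC subrK scalerK.
  have cM := nest_closed NM.
  apply: closed_subspaceZ => //; apply: closed_subspaceB => //.
    exact: closed_subspaceZ.
  exact: nest_alg_inv.
exists B => A; apply: nest_alg_ext => x.
by rewrite nest_alg_subE !nest_alg_mulE !BS SD.
Qed.
End Implementers.

Theorem derivation_inner : exists S : nest_alg N, forall A, D A = A * S - S * A.
Proof.
have [v v0] := X0.
have v2 : 0 < `|v| / 2 by rewrite divr_gt0// normr_gt0.
have [L [NL sL [x0 Lx0 vx0]]] := spanning_dense N v X0 v2.
have x00 : x0 != 0.
  apply: contraTneq vx0 => ->; rewrite subr0 lt_geF// ltr_pdivrMr//.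
  by rewrite ltr_pMr ?normr_gt0// ltr1n.
(* any nonzero vector of a spanning member may serve for the normalisation *)
have [f [bf _ _ fx0 _]] := separation_functional hK
  (nest_closed (nest_zero (nestP N))) (elimN eqP x00).
apply: (implementer_glued bf (x0 := (f x0)^-1 *: x0)).
  by rewrite functionalZ// mulVf.
by exists L; split=> //; apply: closed_subspaceZ => //; exact: nest_closed NL.
Qed.
End InnerDerivations.

(** * Ternary derivations *)

Lemma linear_eqP (K : numFieldType) (U V : lmodType K) (f g : {linear U -> V}) :
  f =1 g -> f = g.
Proof.
case: f g => f [[f0] [fS]] [g [[g0] [gS]]] /= /funext fg.
move: f0 fS g0 gS; rewrite {}fg => f0 fS g0 gS.
by rewrite (Prop_irrelevance f0 g0) (Prop_irrelevance fS gS).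
Qed.

Theorem theorem1p2 (K : numFieldType) (hK : real_or_complex K)
  (X : completeNormedModType K) (hX : dim_ge2 X)
  (N : nest X)
  (hN : forall M : set X, nest_set N M -> nest_pred N M = M -> complemented M)
  (delta tau : {linear nest_alg N -> nest_alg N}) :
  (forall A B : nest_alg N, A * B = 0 -> delta A * B + A * tau B = 0) <->
  (exists! gamma : {linear nest_alg N -> nest_alg N},
     (exists R T : nest_alg N, forall A, gamma A = R * A + A * T) /\
     ternary_derivation gamma delta tau).
Proof.
split=> [zp|[gamma [[_ ternary] _]] A B AB0]; last first.
  by rewrite -ternary AB0 linear0.
have X0 : exists v : X, v != 0.
  have [x [y xy]] := hX; exists x; apply/negP => /eqP x0.
  have [|/eqP] := xy 1 0; first by rewrite x0 scaler0 scale0r addr0.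
  by rewrite oner_eq0.
pose J : set (nest_alg N) :=
  [set F | exists x f, rank_one_pair (N := N) x f /\ F = rank_one x f].
pose d (A : nest_alg N) := delta A - delta 1 * A.
have [] := @exchangeable_ideal_derivation _ delta tau J.
- by move=> _ [x [f [xf ->]]]; exact: rank_one_exchangeable.
- move=> A _ [x [f [xf ->]]]; exists (A x), f; rewrite mul_rank_one//.
  by split=> //; exact: rank_one_pairM.
- move=> _ A [x [f [xf ->]]]; exists x, (f \o A); rewrite rank_one_mul//.
  by split=> //; exact: rank_one_pair_comp.
- move=> A H; apply: (rank_one_left_faithful hK X0) => x f xf.
  by apply: H; exists x, f.
- move=> A H; apply: (rank_one_right_faithful hK) => x f xf.
  by apply: H; exists x, f.
move=> dder0 tauE0.
have dder A B : d (A * B) = d A * B + A * d B := dder0 A B.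
have tauE B : tau B = B * tau 1 + d B := tauE0 B.
have ld : linear d.
  move=> a A B; rewrite /d linearP mulrDr -nest_alg_scalerAr scalerBr.
  by rewrite opprD addrACA.
have [S DS] : exists S : nest_alg N, forall A, d A = A * S - S * A.
  pose D : {linear nest_alg N -> nest_alg N} :=
    HB.pack d (GRing.isLinear.Build K _ _ _ d ld).
  exact: (derivation_inner hK hN X0 (D := D) dder).
have deltaE A : delta A = delta 1 * A + d A by rewrite /d addrC subrK.
clear dder0 tauE0; clearbody d.
pose g (A : nest_alg N) := delta A + A * tau 1.
have lg : linear g.
  move=> a A B; rewrite /g linearP mulrDl -nest_alg_scalerAl scalerDr.
  by rewrite addrACA.
pose gamma : {linear nest_alg N -> nest_alg N} :=
  HB.pack g (GRing.isLinear.Build K _ _ _ g lg).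
exists gamma; split; first split.
- exists (delta 1 - S), (S + tau 1) => A; rewrite /= /g deltaE.
  by rewrite DS mulrBl mulrDr [A * S - _]addrC !addrA.
- move=> A B; rewrite /= /g [delta (A * B)]deltaE dder (tauE B).
  by rewrite [delta A]deltaE mulrDl mulrDr !mulrA !addrA [LHS]addrAC.
move=> gamma' [_ ternary]; apply: linear_eqP => A /=.
by rewrite /g -[A in RHS]mulr1 ternary mulr1.
Qed.
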